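(* Assume the following. (1) There exist non-random $D_n>\sqrt2$ and non-random $\overline\theta_S\in\mathbb R^{|S|}$ with $\mathbf F_{n,\overline\theta_S}$ nonsingular such that, with $\mathbb P_0^{(n)}$-probability at least $1-p^{-1}$, for all $S\in\mathscr S_{s_{\max}}$, $D_n^{-1}\mathbf I_{|S|}\preceq \mathbf F_{n,\hat\theta_S}\mathbf F_{n,\overline\theta_S}^{-1}\preceq D_n\mathbf I_{|S|}$ and $\|\mathbf F_{n,\overline\theta_S}^{1/2}(\hat\theta_S-\overline\theta_S)\|_2^2\le D_n|S|\log p$. Moreover $\mathbf F_{n,\theta^*_{S_0}}$ is nonsingular and $\zeta_{n,S_0}^2s_0\log p=o(1)$. (2) $\log\big([\max_{i}b''(x_i^\top\theta_0)]\vee\|\mathbf X_{S_0}\|_\infty\vee\rho_{\min,S_0}^{-1}\vee\rho_{\max,S_0}\big)=O(\log p)$ and $s_0\log p=o(n)$; there are constants $A_5,A_6>0$, $A_7\ge0$ with $p^{-A_5}\le\lambda\le A_6p^{-A_7}$; $\alpha\in(0,1)$; $A_6p^{-A_7}<A_4$; and $\log_p(D_n)=o(1)$. (3) $\|\mathbf X\|_{\max}^2s_0^2\log p/\phi_2^2(\widetilde s_n;\mathbf W_0)=o(n)$. (4) There are constants $A_8,K_{\rm cubic}>0$ with $\max_{S\in\mathscr S_{\Theta_n}}\rho_{\max,S}\le p^{A_8}$ and $\max_{S\in\overline{\mathscr S}_{\Theta_n}}\sup_{u\in\mathbb R^{|S|},\|u\|_2=1}\frac1n\sum_{i=1}^n|x_{i,S}^\top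 u|^3\le K_{\rm cubic}$; and $\big[(s_0^3\log p)^{1/2}\max_{S\in\mathscr S_{\Theta_n}}\zeta_{n,S}\big]\wedge\big[\frac{\sigma_{\max}^2}{\phi_2^3(\widetilde s_n;\mathbf W_0)}(\frac{s_0^3\log p}{n})^{1/2}\big]=o(1)$. (5) $A_4+A_7/2>16\,\alpha\,C_{\rm dev}+\log_p(s_0)+\delta_1$ for some (sufficiently small) constant $\delta_1>0$, and $\big[(s_0^3\log p)^{1/2}\max_{S\in\widetilde{\mathscr S}_{\Theta_n}}\zeta_{n,S}\big]\wedge\big[\frac{\sigma_{\max}^2}{\phi_2^3(\widetilde s_n;\mathbf W_0)}(\frac{s_0^3\log p}{n})^{1/2}\big]=o(1)$. (6) $\|\mathbf X\|_{\max}^2\log p=o(n)$, $\max_{j\in[p]}\|\mathbf x_j\|_2=O(n^{1/2})$, there exists $\kappa_n>1$ with $\max_{S\in\mathscr S_{\rm fp}}\|\mathbf F_{n,\theta_S^*}^{-1}\|_\infty\le\kappa_nn^{-1}$, and $$\Big[\frac{(s_0^2\log p)^{1/2}\max_{S\in\mathscr S_{\rm fp}}\zeta_{n,S}}{\phi_2(\widetilde s_n;\mathbf W_0)\nu_n\kappa_n}\Big]\wedge\Big[\frac{\sigma_{\max}^2}{\phi_2^4(\widetilde s_n;\mathbf W_0)\nu_n\kappa_n}\Big(\frac{s_0^2\log p}{n}\Big)^{1/2}\Big]=o(1).$$ Then there exists a constant $K>0$ such that, for all sufficiently large $n$, with $\mathbb P_0^{(n)}$-probability at least $1-3p^{-1}$,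 $$\max_{S\in\mathscr S_{\rm fp}}\|\hat\theta_S-\theta_S^*\|_\infty\le K\nu_n\kappa_n\sqrt{\frac{\log p}{n}}.$$
   Context: Asymptotics are as $n\to\infty$; $p,\mathbf X,\theta_0,s_{\max},w_n,\lambda,D_n,\kappa_n$ may depend on $n$, quantities called constants do not. $p\ge n^{c}$ for some constant $c>0$. The covariates $x_1,\dots,x_n\in\mathbb R^p$ are non-random; $\mathbf X=(x_{ij})\in\mathbb R^{n\times p}$ has rows $x_i^\top$ and columns $\mathbf x_j$. Model: $p_\theta(y\mid x)=\exp\{y\,x^\top\theta-b(x^\top\theta)+k(y)\}$ with $b,k$ known, $b$ strictly convex and three times differentiable; $C_{\rm dev}\ge1$ is a constant depending only on $b$ with $\sup_{|y|\le1/2}b''(x+y)\le C_{\rm dev}b''(x)$ for all $x\in\mathbb R$. $Y_1,\dots,Y_n$ are independent, $Y_i$ with density/mass function $p_{\theta_0}(\cdot\mid x_i)$ for a true $\theta_0\in\mathbb R^p\setminus\{0\}$; $\mathbb P_0^{(n)},\mathbb E$ are the corresponding probability and expectation. $S_\theta=\{j:\theta_j\ne0\}$, $S_0=S_{\theta_0}$, $s_0=|S_0|$, $[p]=\{1,\dots,p\}$, $\mathscr S_s=\{S\subset[p]:|S|\le s\}$. For $S\subseteq[p]$: $x_{i,S}=(x_{ij})_{j\in S}$, $\mathbf X_S$ is the submatrix of columns in $S$; for $\theta_S\in\mathbb R^{|S|}$, $\widetilde\theta_S\in\mathbb R^p$ is its extension by zeros off $S$; $L_{n,\theta_S}=\sum_i\{Y_ix_{i,S}^\top\theta_S-b(x_{i,S}^\top\theta_S)+k(Y_i)\}$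 ($L_{n,\theta}$ is the case $S=[p]$); $\hat\theta_S=\arg\max L_{n,\theta_S}$ (MLE), $\theta_S^*=\arg\max\mathbb E L_{n,\theta_S}$; $\mathbf F_{n,\theta_S}=\sum_ib''(x_{i,S}^\top\theta_S)x_{i,S}x_{i,S}^\top$ ($\mathbf F_{n,\theta}$ is the case $S=[p]$); $\zeta_{n,S}=\max_i\|\mathbf F_{n,\theta_S^*}^{-1/2}x_{i,S}\|_2$; $\rho_{\min,S},\rho_{\max,S}$ are the smallest and largest eigenvalues of $\mathbf F_{n,\theta_S^*}$; $\sigma_{\max}^2=\max_ib''(x_i^\top\theta_0)$; $\nu_n=(1+\frac{2}{e\log2})(1+\frac{\sigma_{\max}^2}{\log2})$. For matrices, $\|\mathbf A\|_\infty=\max_i\sum_j|a_{ij}|$, $\|\mathbf A\|_{\max}=\max_{i,j}|a_{ij}|$. The relation $D_n^{-1}\mathbf I\preceq\mathbf F\mathbf G^{-1}\preceq D_n\mathbf I$ is read as $D_n^{-1}\mathbf G\preceq\mathbf F\preceq D_n\mathbf G$ in the positive semidefinite order. $\mathbf W_0=\mathrm{diag}(b''(x_1^\top\theta_0),\dots,b''(x_n^\top\theta_0))$; $\phi_2^2(s;\mathbf W)=\inf\{n^{-1}\theta^\top\mathbf X^\top\mathbf W\mathbf X\theta/\|\theta\|_2^2:0<|S_\theta|\le s\}$. Prior: $s_{\max}$ is an integer with $s_0\le s_{\max}\le\operatorname{rank}(\mathbf X)$; $w_n$ is a probability mass function on $\{0,\dots,s_{\max}\}$ and $A_1,\dots,A_4>0$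 are constants with $A_1p^{-A_3}w_n(s-1)\le w_n(s)\le A_2p^{-A_4}w_n(s-1)$ for $1\le s\le s_{\max}$; $\pi_n(S)=w_n(|S|)\binom{p}{|S|}^{-1}$; for $\lambda>0$, $g_S$ is the density of $\mathcal N(\hat\theta_S,\{\lambda\mathbf F_{n,\hat\theta_S}\}^{-1})$ on $\mathbb R^{|S|}$. The (data-dependent) prior is $\Pi_n(d\theta)=\sum_S\pi_n(S)g_S(\theta_S)\,d\theta_S\times\delta_0(d\theta_{S^c})$ and the $\alpha$-fractional posterior is $\Pi_\alpha^n(\mathcal A)=\int_{\mathcal A}e^{\alpha L_{n,\theta}}\Pi_n(d\theta)\big/\int e^{\alpha L_{n,\theta}}\Pi_n(d\theta)$. $K_{\rm dim}>1$ and $K_{\rm theta}>0$ are fixed constants (they exist under hypotheses (1)–(3)) such that for all sufficiently large $n$: $\mathbb E\,\Pi_\alpha^n\{|S_\theta|>K_{\rm dim}s_0\}\le(s_0\log p)^{-1}+2p^{-1}+p^{-s_0}$ and $\mathbb E\,\Pi_\alpha^n\{\|\mathbf F_{n,\theta_0}^{1/2}(\theta-\theta_0)\|_2^2>K_{\rm theta}s_0\log p\}\le2(s_0\log p)^{-1}+4p^{-1}+2p^{-s_0}$. $s_n=K_{\rm dim}s_0$, $\widetilde s_n=(K_{\rm dim}+1)s_0$; $\mathscr S_{\Theta_n}=\{S\in\mathscr S_{s_n}:\|\mathbf F_{n,\theta_0}^{1/2}(\widetilde\theta_S-\theta_0)\|_2^2\le K_{\rm theta}s_0\log p\text{ for some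 }\theta_S\in\mathbb R^{|S|}\}$; $\widetilde{\mathscr S}_{\Theta_n}=\{S\cup S_0:S\in\mathscr S_{\Theta_n}\}$; $\overline{\mathscr S}_{\Theta_n}=\mathscr S_{\Theta_n}\cup\widetilde{\mathscr S}_{\Theta_n}$; $\mathscr S_{\rm fp}=\{S\cup S_0:S\in\mathscr S_{\Theta_n},\,S\nsupseteq S_0\}$. *)

(* Defs.v *)
From HB Require Import structures.
From mathcomp Require Import all_boot all_order all_algebra.
From mathcomp Require Import all_classical all_reals all_analysis.

Set Implicit Arguments.
Unset Strict Implicit.
Unset Printing Implicit Defensive.

Import Order.TTheory GRing.Theory Num.Theory.
Import numFieldNormedType.Exports.

Local Open Scope classical_set_scope.
Local Open Scope ring_scope.

Section matrices.
Context {R : realType}.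

Definition norm2 m (v : 'cV[R]_m) : R := Num.sqrt (\sum_i v i 0 ^+ 2).

(* The maximal absolute row sum of A; the entrywise norm max_(i,j) |A i j| is
   the library norm `|A|. *)
Definition row_sum_norm m n (A : 'M[R]_(m, n)) : R :=
  \big[Num.max/0]_i \sum_j `|A i j|.

Definition psdmx m (A : 'M[R]_m) : Prop :=
  A^T = A /\ forall v : 'cV[R]_m, 0 <= (v^T *m A *m v) 0 0.

Definition loewner_le m (A B : 'M[R]_m) : Prop := psdmx (B - A).

(* The positive semidefinite square root A^(1/2); it exists and is unique when
   A is positive semidefinite, otherwise the value is 0. *)
Definition sqrtmx m (A : 'M[R]_m) : 'M[R]_m :=
  xget 0 [set B | psdmx B /\ B *m B = A].

Definition eigval_min m (A : 'M[R]_m) : R := inf [set a | eigenvalue A a].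
Definition eigval_max m (A : 'M[R]_m) : R := sup [set a | eigenvalue A a].

Definition is_argmax {d} {T : porderType d} m (f : 'cV[R]_m -> T)
    (t : 'cV[R]_m) : Prop :=
  forall u, (f u <= f t)%O.

(* A maximiser of f if there is one, and 0 otherwise. *)
Definition argmax {d} {T : porderType d} m (f : 'cV[R]_m -> T) : 'cV[R]_m :=
  xget 0 [set t | is_argmax f t].

Definition supp m (t : 'cV[R]_m) : {set 'I_m} := [set j | t j 0 != 0]%SET.

Definition cols n p (X : 'M[R]_(n, p)) (S : {set 'I_p}) : 'M[R]_(n, #|S|) :=
  colsub (fun k : 'I_#|S| => enum_val k) X.

Definition extend p (S : {set 'I_p}) (t : 'cV[R]_#|S|) : 'cV[R]_p :=
  \col_j \sum_(k | enum_val k == j) t k 0.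

Definition phi2 n p (X : 'M[R]_(n, p)) (W : 'M[R]_n) (s : R) : R :=
  Num.sqrt (inf [set n%:R^-1 * (t^T *m X^T *m W *m X *m t) 0 0 / norm2 t ^+ 2
                | t in [set t : 'cV[R]_p |
                          (0 < #|supp t|)%N && (#|supp t|%:R <= s)]]).

(* The Lebesgue integral over R^m, as an iterated integral; by Tonelli's theorem
   this is the usual one for nonnegative measurable f, the only case used. *)
Fixpoint integral_cV m : ('cV[R]_m -> \bar R) -> \bar R :=
  match m with
  | 0 => fun f => f 0
  | m'.+1 => fun f =>
      (\int[@lebesgue_measure R]_x
         integral_cV (fun v : 'cV[R]_m' => f (col_mx (const_mx x : 'cV[R]_1) v)))%E
  end.

Definition gauss_density m (mu : 'cV[R]_m) (Sigma : 'M[R]_m) (t : 'cV[R]_m) : R :=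
  (Num.sqrt (\det ((2 * pi) *: Sigma)))^-1 *
  expR (- (2^-1 * ((t - mu)^T *m invmx Sigma *m (t - mu)) 0 0)).

End matrices.

Section probability.
Context {R : realType} d {T : measurableType d} (P : probability T R).

(* An event of probability at least q holds inside E; for measurable E this says
   that P E >= q, and it avoids asserting that E itself is measurable. *)
Definition with_prob_ge (q : R) (E : set T) : Prop :=
  exists A : set T, [/\ measurable A, A `<=` E & (q%:E <= P A)%E].

Definition mutually_independent n (Y : 'I_n -> {RV P >-> R}) : Prop :=
  forall (J : {set 'I_n}) (B : 'I_n -> set R),
    (forall i, measurable (B i)) ->
    fine (P [set w | forall i, i \in J -> B i (Y i w)]) =
    \prod_(i in J) fine (P (Y i @^-1` B i)).

End probability.

Section family.
Context {R : realType}.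

Definition strictly_convex (b : R -> R) : Prop :=
  forall x y t : R, x != y -> 0 < t < 1 ->
    b (t * x + (1 - t) * y) < t * b x + (1 - t) * b y.

Definition thrice_differentiable (b : R -> R) : Prop :=
  forall (i : nat) (x : R), (i < 3)%N -> derivable (derive1n i b) x 1.

Definition glm_density (b k : R -> R) (eta y : R) : R :=
  expR (y * eta - b eta + k y).

(* Densities are taken with respect to mu restricted to D: D is the set of
   possible responses, and mu is Lebesgue measure (probability density
   functions) or counting measure on a countable D (mass functions).  The
   density integrates to 1 for every value eta of the linear predictor. *)
Definition glm_family (b k : R -> R)
    (mu : {measure set (measurableTypeR R) -> \bar R}) (D : set R) : Prop :=
  [/\ strictly_convex b /\ thrice_differentiable b,
      measurable_fun [set: R] k,
      (measurable D /\ forall B, measurable B -> mu B = lebesgue_measure B) \/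
      (countable D /\ forall B, measurable B -> mu B = counting B) &
      forall eta : R, (\int[mu]_(y in D) (glm_density b k eta y)%:E = 1)%E].

End family.

Record glm (R : realType) (n : nat) := GLM {
  ncov : nat ;
  design : 'M[R]_(n, ncov) ;
  truth : 'cV[R]_ncov ;
  disp : measure_display ;
  space : measurableType disp ;
  prob : probability space R ;
  resp : 'I_n -> {RV prob >-> R} }.

Section objects.
Context {R : realType} (b k : R -> R) {n : nat} (M : glm R n).

Local Notation p := (ncov M).
Local Notation X := (design M).
Local Notation theta0 := (truth M).
Local Notation Omega := (space M).
Local Notation P := (prob M).

(* The integrability of k (Y i) is implicit in the use of E L_(n,theta): without
   it that expectation, hence theta*_S, is undefined. *)
Definition glm_model (mu : {measure set (measurableTypeR R) -> \bar R})
    (D : set R) : Prop :=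
  [/\ mutually_independent (resp M),
      forall (i : 'I_n) (B : set (measurableTypeR R)), measurable B ->
        distribution P (resp M i) B =
        (\int[mu]_(y in B `&` D)
          (glm_density b k ((X *m theta0) i 0) y)%:E)%E &
      forall i : 'I_n,
        P.-integrable [set: Omega] (fun w => (k (resp M i w))%:E)].

Definition logp (x : R) : R := ln x / ln p%:R.

Definition S0 : {set 'I_p} := supp theta0.
Definition s0 : nat := #|S0|.

(* Z is X for the full model and cols X S for the model S. *)
Definition loglik m (Z : 'M[R]_(n, m)) (w : Omega) (t : 'cV[R]_m) : R :=
  \sum_i (resp M i w * (Z *m t) i 0 - b ((Z *m t) i 0) + k (resp M i w)).

Definition fisher m (Z : 'M[R]_(n, m)) (t : 'cV[R]_m) : 'M[R]_m :=
  \sum_i derive1n 2 b ((Z *m t) i 0) *: ((row i Z)^T *m row i Z).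

Definition F0 : 'M[R]_p := fisher X theta0.
Definition F_ (S : {set 'I_p}) (t : 'cV[R]_#|S|) : 'M[R]_#|S| :=
  fisher (cols X S) t.

Definition mle (S : {set 'I_p}) (w : Omega) : 'cV[R]_#|S| :=
  argmax (loglik (cols X S) w).
Definition is_mle (S : {set 'I_p}) (w : Omega) : 'cV[R]_#|S| -> Prop :=
  is_argmax (loglik (cols X S) w).

Definition theta_star (S : {set 'I_p}) : 'cV[R]_#|S| :=
  argmax (fun t => 'E_P[fun w => loglik (cols X S) w t])%E.
Definition F_star (S : {set 'I_p}) : 'M[R]_#|S| := F_ (theta_star S).

Definition zeta (S : {set 'I_p}) : R :=
  \big[Num.max/0]_(i < n)
    norm2 (invmx (sqrtmx (F_star S)) *m (row i (cols X S))^T).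
Definition rho_min (S : {set 'I_p}) : R := eigval_min (F_star S).
Definition rho_max (S : {set 'I_p}) : R := eigval_max (F_star S).

Definition sigma2_max : R := \big[Num.max/0]_(i < n) derive1n 2 b ((X *m theta0) i 0).
Definition nu : R :=
  (1 + 2 / (expR 1 * ln 2)) * (1 + sigma2_max / ln 2).
Definition W0 : 'M[R]_n := diag_mx (\row_i derive1n 2 b ((X *m theta0) i 0)).

Definition dist0 (theta : 'cV[R]_p) : R :=
  norm2 (sqrtmx F0 *m (theta - theta0)) ^+ 2.

Section posterior.
Variables (smax : nat) (wgt : nat -> R) (lambda alpha : R).

Definition prior_weights (A1 A2 A3 A4 : R) : Prop :=
  [/\ forall s, (s <= smax)%N -> 0 <= wgt s,
      \sum_(0 <= s < smax.+1) wgt s = 1 &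
      forall s, (1 <= s <= smax)%N ->
        A1 * p%:R `^ (- A3) * wgt s.-1 <= wgt s
          <= A2 * p%:R `^ (- A4) * wgt s.-1].

Definition model_weight (S : {set 'I_p}) : R := wgt #|S| / 'C(p, #|S|)%:R.

Definition slab (w : Omega) (S : {set 'I_p}) : 'cV[R]_#|S| -> R :=
  gauss_density (mle S w) (invmx (lambda *: F_ (mle S w))).

(* The integral of f >= 0 against the data-dependent prior Pi_n; models with more
   than smax covariates have prior mass 0. *)
Definition prior_integral (w : Omega) (f : 'cV[R]_p -> R) : \bar R :=
  (\sum_(S : {set 'I_p} | (#|S| <= smax)%N)
     (model_weight S)%:E *
     integral_cV (fun t : 'cV[R]_#|S| => (f (extend t) * slab w t)%:E))%E.

(* The value is only meaningful when the maximum likelihood estimators exist and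
   their information matrices are nonsingular. *)
Definition frac_posterior (A : set 'cV[R]_p) (w : Omega) : R :=
  let lik theta := expR (alpha * loglik X w theta) in
  fine (prior_integral w (fun theta => \1_A theta * lik theta)) /
  fine (prior_integral w lik).

End posterior.

Section classes.
Variables Kdim Ktheta : R.

Definition S_Theta : {set {set 'I_p}} :=
  [set S : {set 'I_p} | (#|S|%:R <= Kdim * s0%:R) &&
    `[< exists t : 'cV[R]_#|S|,
          dist0 (extend t) <= Ktheta * s0%:R * ln p%:R >]]%SET.
Definition S_Theta_tilde : {set {set 'I_p}} :=
  [set S :|: S0 | S in S_Theta]%SET.
Definition S_Theta_bar : {set {set 'I_p}} := S_Theta :|: S_Theta_tilde.
Definition S_fp : {set {set 'I_p}} :=
  [set S :|: S0 | S in S_Theta & ~~ (S0 \subset S)]%SET.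

Definition max_zeta (C : {set {set 'I_p}}) : R :=
  \big[Num.max/0]_(S in C) zeta S.

(* phi_2(s~_n; W_0) with s~_n = (Kdim + 1) s_0 *)
Definition phi2_tilde : R := phi2 X W0 ((Kdim + 1) * s0%:R).

End classes.

End objects.

(* Main.v *)
Require Import Defs.
From HB Require Import structures.
From mathcomp Require Import all_boot all_order all_algebra.
From mathcomp Require Import all_classical all_reals all_analysis.
From mathcomp Require Import measurable_realfun ring lra.

(** A model [S] of the class [S_fp] contains the true support and has at most
    [(Kdim + 1) s0] covariates.  The Kullback-Leibler inequality therefore makes
    [theta_star S] the restriction of [theta0], and [F_star S] is the Gram matrix
    of the columns of [S] with weights [V_i = b'' (x_i^T theta0)]
    ([theta_star_unique]).  Write [eps_i = Y_i - b' (x_i^T theta0)], [Delta] for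
    the error of the maximum likelihood estimator, [q] for the quadratic form of
    [F_star S] and [sigma^2] for [sigma2_max].  The score equation reads
    [F_star S Delta = X_S^T eps - r], where [r] collects the second order
    remainders of [b'], so that
    [|Delta| <= (kappa / n) (|X_S^T eps| + |r|)] in the maximum norm.

    The noise has the moment generating function of an exponential family, which
    the condition on [b''] bounds by that of a Gaussian of variance [2 C V_i] for
    arguments up to 1/2; Chernoff's inequality ([noise_sum_tail]) gives two events
    of probability at least [1 - 1/p].  On the first ([score_event]), all the
    coordinates of [X^T eps] are at most a multiple of [nu sqrt (n ln p)].  On the
    second ([direction_event]), [eps^T X_S v <= tau sqrt (q v)] with
    [tau ~ sqrt (s0 ln p)], for every sparse [S] containing the true support and
    every direction [v]: the supremum over the sphere is replaced by a maximum over
    an integer grid in coordinates that are orthonormal for [q], and the union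
    bound over grids and models costs [O(s0 ln p)] in the exponent.

    On the second event the likelihood is smaller on the ellipsoid
    [sqrt (q (t - theta_star)) = 3 C tau] than at its centre, because [b'']
    changes by a factor at most [C] there: the restricted eigenvalue condition [H3]
    makes all the predictors move by at most 1/2.  By concavity it is smaller
    outside the ellipsoid as well, so the estimator exists and lies inside
    ([mle_exists], [mle_close]).

    It remains to bound [r], which needs a modulus of continuity of [b''] and not
    only its oscillation.  Since [exp b] is a Laplace transform, inequalities
    between exponentials pass to it ([laplace_positive]); this yields
    [|b' (x + d) - b' x - b'' x d| <= K V (2 + sqrt V) d^2] with [V = b'' x]
    ([score_remainder_le]).  The factor [sqrt V] is the natural scale: the third
    cumulant may be as large as [V^(3/2)].  Hence
    [|r| <= K |X| (2 + sigma) q(Delta)] with [q(Delta) = O(s0 ln p)].  Condition [H3]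
    bounds [|X| s0 sqrt (ln p)] by a multiple of [phi2 sqrt n], and
    [phi2 = O(sigma)] because a single column already gives that bound
    ([phi2_tilde_le]).  So [|r|] is at most a multiple of
    [sigma (2 + sigma) sqrt (n ln p)], which [nu >= 1 + sigma^2] absorbs
    ([remainder_term_le]). *)

Set Implicit Arguments.
Unset Strict Implicit.
Unset Printing Implicit Defensive.

Import Order.TTheory GRing.Theory Num.Theory.
Import numFieldNormedType.Exports.

Local Open Scope classical_set_scope.
Local Open Scope ring_scope.

Local Arguments derive1n : simpl never.

(** * Densities and independence *)

Section density.
Local Open Scope ereal_scope.
Import HBNNSimple.

(** The hypothesis says that the image by [X] of the measure of density [G] is
    [c nu].  Two instances are needed: the law of a response has a density (with
    [X] the identity), and conditioning on the other independent factors ([G] is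
    their product and [nu] the law of the remaining variable). *)
Lemma ge0_integral_density (R : realType) d (T : measurableType d)
    d' (U : measurableType d')
    (m : {measure set T -> \bar R}) (nu : {measure set U -> \bar R})
    (D : set T) (G : T -> R) (X : T -> U) (c : R) :
  measurable D -> measurable_fun D G -> (forall x, 0 <= G x)%R ->
  measurable_fun [set: T] X -> (0 <= c)%R ->
  (forall B, measurable B ->
     \int[m]_(x in D) (G x * \1_B (X x))%:E = c%:E * nu B) ->
  forall f : U -> R, measurable_fun [set: U] f -> (forall u, 0 <= f u)%R ->
    \int[m]_(x in D) (G x * f (X x))%:E = c%:E * \int[nu]_u (f u)%:E.
Proof.
move=> mD mG G0 mX c0 GXnu f mf f0.
have mX' : measurable_fun D X by exact: measurable_funTS.
have simple : forall h : {nnsfun U >-> R},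
    \int[m]_(x in D) (G x * h (X x))%:E = c%:E * \int[nu]_u (h u)%:E.
  move=> h; rewrite (_ : \int[nu]_u (h u)%:E = sintegral nu h); last exact: integralT_nnsfun.
  rewrite sintegralE.
  under eq_integral => x _.
    rewrite fimfunE mulr_fsumr -fsumEFin//.
    over.
  rewrite ge0_integral_fsum//; last 2 first.
  - move=> y; apply/measurable_EFinP; apply: measurable_funM => //.
    apply: measurable_funM => //.
    apply: measurableT_comp => //.
  - move=> y x Dx; rewrite lee_fin mulr_ge0//.
    case: (ltP y 0%R) => [y0|y0]; last by rewrite mulr_ge0.
    by rewrite preimage_nnfun0// indicE in_set0 mulr0.
  rewrite ge0_mule_fsumr; last exact: nnsfun_mulemu_ge0.
  apply: eq_fsbigr => y; rewrite inE => -[x _ <-{y}].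
  under eq_integral => z _ do rewrite mulrCA EFinM.
  rewrite ge0_integralZl//.
  - rewrite GXnu; first by rewrite muleCA.
    exact: measurable_sfunP.
  - apply/measurable_EFinP; apply: measurable_funM => //.
    apply: measurableT_comp => //.
  - by move=> z Dz; rewrite lee_fin mulr_ge0.
  by rewrite lee_fin; exact: fun_ge0.
have mf' : measurable_fun [set: U] (EFin \o f) by exact/measurable_EFinP.
pose h := nnsfun_approx measurableT mf'.
have hf u : EFin \o h ^~ u @ \oo --> (f u)%:E.
  by apply: cvg_nnsfun_approx => // v _; rewrite lee_fin.
have ndh u : {homo (fun n => h n u) : n k / (n <= k)%O >-> (n <= k)%R}.
  by move=> n k nk; apply/lefP/nd_nnsfun_approx.
have L : (fun n => \int[m]_(x in D) (G x * h n (X x))%:E) @ \oo -->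
    \int[m]_(x in D) (G x * f (X x))%:E.
  rewrite (_ : \int[m]_(x in D) (G x * f (X x))%:E =
     \int[m]_(x in D) limn (fun n => (G x * h n (X x))%:E)); last first.
    apply: eq_integral => x _; apply/esym/cvg_lim => //.
    rewrite EFinM; under eq_fun do rewrite EFinM.
    by apply: cvgeZl => //; exact: hf.
  apply: cvg_monotone_convergence => //.
  - move=> n; apply/measurable_EFinP; apply: measurable_funM => //.
    apply: measurableT_comp => //.
  - by move=> n x _; rewrite lee_fin mulr_ge0.
  - by move=> x _ n k nk; rewrite lee_fin ler_wpM2l//; exact: ndh.
have Rr : (fun n => \int[nu]_u (h n u)%:E) @ \oo --> \int[nu]_u (f u)%:E.
  rewrite (_ : \int[nu]_u (f u)%:E = \int[nu]_u limn (fun n => (h n u)%:E));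
    last first.
    by apply: eq_integral => x _; apply/esym/cvg_lim => //; exact: hf.
  apply: cvg_monotone_convergence => //.
  - by move=> n; exact/measurable_EFinP.
  - by move=> n x _; rewrite lee_fin.
  - by move=> x _ n k nk; rewrite lee_fin; exact: ndh.
rewrite -(cvg_lim _ L)//; apply: cvg_lim => //.
under eq_fun do rewrite simple.
by apply: cvgeZl.
Qed.

End density.

(** Independence is the case of indicator functions.  The indicators are replaced
    by the functions [f i] one at a time: at stage [k] the first [k] factors are
    [f i (Y i)] and the others are indicators of arbitrary measurable sets. *)
Lemma integral_prod_independent (R : realType) d (T : measurableType d)
    (P : probability T R) n (Y : 'I_n -> {RV P >-> R})
    (f : 'I_n -> R -> R) (c : 'I_n -> R) :
  mutually_independent Y ->
  (forall i, measurable_fun [set: R] (f i)) -> (forall i u, 0 <= f i u) ->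
  (forall i, 0 <= c i) ->
  (forall i, \int[P]_w (f i (Y i w))%:E = (c i)%:E)%E ->
  (\int[P]_w (\prod_i f i (Y i w))%:E = (\prod_i c i)%:E)%E.
Proof.
move=> indY mf f0 c0 fY.
pose g (k : nat) (B : 'I_n -> set R) (i : 'I_n) :=
  if (i < k)%N then f i else \1_(B i).
pose e (k : nat) (B : 'I_n -> set R) (i : 'I_n) :=
  if (i < k)%N then c i else fine (P (Y i @^-1` B i)).
have mg k B i : measurable (B i) -> measurable_fun [set: R] (g k B i).
  by move=> mB; rewrite /g; case: ifP.
have g0 k B i u : 0 <= g k B i u by rewrite /g; case: ifP.
have e0 k B i : 0 <= e k B i.
  by rewrite /e; case: ifP => // _; exact/fine_ge0.
have main k : (k <= n)%N -> forall B, (forall i, measurable (B i)) ->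
    (\int[P]_w (\prod_i g k B i (Y i w))%:E = (\prod_i e k B i)%:E)%E.
  elim: k => [_ B mB|k IH kn B mB].
    have -> : (\prod_i e 0 B i) =
        fine (P [set w | forall i, i \in [set: 'I_n]%SET -> B i (Y i w)]).
      by rewrite indY//; apply: eq_big => // i; rewrite inE.
    have mE : measurable [set w | forall i, i \in [set: 'I_n]%SET -> B i (Y i w)].
      rewrite (_ : [set w | _] = \bigcap_(i in [set: 'I_n]) (Y i @^-1` B i)); last first.
        apply/seteqP; split=> w /= H i.
          by move=> _; apply: H; rewrite inE.
        by move=> _; exact: (H i).
      apply: fin_bigcap_measurable => //= i _.
      by rewrite -[X in measurable X]setTI; exact: measurable_funP.
    rewrite fineK ?fin_num_measure//.
    rewrite -[X in P X]setIT -integral_indic//.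
    apply: eq_integral => w _; congr EFin.
    under eq_bigr do rewrite /g ltn0 indicE.
    rewrite indicE; case: (boolP (_ \in _)) => [|/negP] Ew.
      rewrite big1// => i _; move: Ew; rewrite inE/= => Ew.
      by rewrite mem_set//; apply: Ew; rewrite inE.
    have [i Bi] : exists i, ~ B i (Y i w).
      apply/existsNP => H; apply: Ew; rewrite inE/= => i _; exact: H.
    by rewrite (bigD1 i)//= memNset// mul0r.
  pose i0 := Ordinal kn.
  have i0P (i : 'I_n) : i != i0 -> (i < k.+1)%N = (i < k)%N.
    by move=> ii0; rewrite ltnS leq_eqVlt -[k]/(val i0) (inj_eq val_inj) (negbTE ii0).
  rewrite (bigD1 i0)//= {1}/e ltnSn mulrC EFinM -fY.
  rewrite -(@ge0_integral_distribution _ _ _ _ _ P (Y i0) (EFin \o f i0)); last 2 first.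
  - exact/measurable_EFinP.
  - by move=> u; rewrite lee_fin.
  rewrite -(@ge0_integral_density _ _ _ _ _ P _ [set: T]
     (fun w => \prod_(i | i != i0) g k.+1 B i (Y i w)) (Y i0)) => //.
  - apply: eq_integral => w _; congr EFin.
    by rewrite (bigD1 i0)//= mulrC {2}/g ltnSn.
  - under eq_fun do rewrite -big_filter.
    apply: measurable_prod => i _.
    by apply: measurableT_comp => //; exact: mg.
  - by move=> w; apply: prodr_ge0.
  - by apply: prodr_ge0.
  (* The measure of A is read off the previous stage, with A in place of B i0. *)
  move=> A mA.
  pose B' i := if i == i0 then A else B i.
  have mB' i : measurable (B' i) by rewrite /B'; case: ifP.
  have := IH (ltnW kn) B' mB'.
  rewrite (bigD1 i0)//= {1}/e ltnn /B' eqxx.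
  rewrite mulrC EFinM fineK; last first.
    apply: fin_num_measure; rewrite -[X in measurable X]setTI.
    exact: measurable_funP.
  move=> IHA; rewrite (_ : (\prod_(i | i != i0) e k.+1 B i) =
    \prod_(i | i != i0) e k B' i); last first.
    by apply: eq_bigr => i ii0; rewrite /e i0P// /B' (negbTE ii0).
  rewrite /distribution/= /pushforward -IHA; apply: eq_integral => w _; congr EFin.
  rewrite [RHS](bigD1 i0)//= [RHS]mulrC; congr (_ * _); last first.
    by rewrite /g ltnn eqxx.
  by apply: eq_bigr => i ii0; rewrite /g i0P// /B' (negbTE ii0).
move: (main n (leqnn n) (fun=> setT) (fun=> measurableT)).
rewrite (eq_bigr c); last by move=> i _; rewrite /e ltn_ord.
move=> <-; apply: eq_integral => w _; congr EFin.
by apply: eq_bigr => i _; rewrite /g ltn_ord.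
Qed.

(** * The family as a Laplace transform *)

Section exponential_family.
Context (R : realType) (b k : R -> R)
  (mu : {measure set (measurableTypeR R) -> \bar R}) (Dom : set R).
Hypothesis family : glm_family b k mu Dom.

Lemma measurable_response_set : measurable (Dom : set (measurableTypeR R)).
Proof.
case: family => _ _ [[//]|[cD _]] _.
exact: countable_measurable.
Qed.

Lemma measurable_glm_density eta (A : set R) :
  measurable_fun A (glm_density b k eta).
Proof.
case: family => _ mk _ _.
apply: measurable_funTS; apply: measurableT_comp => //.
apply: measurable_funD => //; apply: measurable_funB => //.
exact: measurable_funM.
Qed.

Lemma integrable_glm_density eta :
  mu.-integrable Dom (EFin \o glm_density b k eta).
Proof.
apply/integrableP; split.
  apply/measurable_EFinP. exact: measurable_glm_density.
case: family => _ _ _ /(_ eta) H; under eq_integral => y _.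
  rewrite /= ger0_norm ?expR_ge0//; over.
by rewrite H ltry.
Qed.

(** [expR (b t)] is the integral of [expR (t y + k y)], so inequalities between
    exponentials in [y] integrate to inequalities for [expR \o b].  This gives
    access to the derivatives of [b] through finite differences, without
    differentiating under the integral sign. *)
Lemma laplace_positive (l : seq (R * R)) :
  (forall y, 0 <= \sum_(q <- l) q.1 * expR (q.2 * y)) ->
  0 <= \sum_(q <- l) q.1 * expR (b q.2).
Proof.
move=> l0; have mD := measurable_response_set.
have : (0 <= \int[mu]_(y in Dom) \sum_(q <- l)
    ((q.1 * expR (b q.2))%:E * (glm_density b k q.2 y)%:E))%E.
  apply: integral_ge0 => y _.
  under eq_bigr do rewrite -EFinM; rewrite sumEFin lee_fin.
  rewrite (_ : \sum_(q <- l) _ =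
      (\sum_(q <- l) q.1 * expR (q.2 * y)) * expR (k y)).
    by rewrite mulr_ge0// expR_ge0.
  rewrite mulr_suml; apply: eq_bigr => q _.
  rewrite /glm_density -!mulrA -!expRD; congr (_ * expR _); ring.
rewrite (integral_sum mD) => [|q]; last first.
  by apply: integrableZl => //; exact: integrable_glm_density.
rewrite (eq_bigr (fun q => (q.1 * expR (b q.2))%:E)) => [|q _].
  by rewrite sumEFin lee_fin.
rewrite (integralZl mD (integrable_glm_density q.2)).
by case: family => _ _ _ ->; rewrite mule1.
Qed.

End exponential_family.

(** * Mean values and second differences *)

Section mean_value.
Context (R : realType).

Lemma MVT_ray (f df : R -> R) : (forall x : R, is_derive x 1 f (df x)) ->
  forall x d, exists2 t, 0 <= t <= 1 & f (x + d) - f x = df (x + t * d) * d.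
Proof.
move=> fdf x d.
have line (t : R) : is_derive t 1 (fun t => x + t * d) d.
  rewrite (_ : (fun t => _) = cst x + d *: (@id R)); last first.
    by apply/funext => u /=; rewrite !fctE mulrC.
  apply: (is_derive_eq (is_deriveD (is_derive_cst x t 1)
    (is_deriveZ d (is_derive_id t 1)))).
  by rewrite add0r; exact: mulr1.
have dg (t : R) : is_derive t 1 (fun t => f (x + t * d)) (df (x + t * d) * d).
  exact: (@is_derive1_comp R f (fun t => x + t * d)).
have cg : {within `[0, 1], continuous (fun t => f (x + t * d))}.
  apply: continuous_subspaceT => t; apply/differentiable_continuous.
  exact/derivable1_diffP.
have [t] := MVT_segment ler01 (fun t _ => dg t) cg.
rewrite in_itv/= => t01; rewrite mul1r mul0r addr0 subr0 mulr1 => fE.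
by exists t.
Qed.

Lemma second_difference (f f1 f2 : R -> R) :
  (forall x : R, is_derive x 1 f (f1 x)) -> (forall x : R, is_derive x 1 f1 (f2 x)) ->
  forall x g, exists2 t, 0 <= t <= 2 &
    f (x + 2 * g) - 2 * f (x + g) + f x = f2 (x + t * g) * g ^+ 2.
Proof.
move=> df df1 x g.
have shift (t : R) : is_derive t 1 (fun t => t + g) 1.
  rewrite (_ : (fun t => _) = (@id R) + cst g)//.
  by apply: is_derive_eq; rewrite addr0.
have dF (t : R) : is_derive t 1 (fun t => f (t + g) - f t) (f1 (t + g) - f1 t).
  apply: is_deriveB; rewrite -[f1 _]mulr1.
  exact: (@is_derive1_comp R f (fun t => t + g)).
have [t /andP[t0 t1] Ht] := MVT_ray dF x g.
have [u /andP[u0 u1] Hu] := MVT_ray df1 (x + t * g) g.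
exists (t + u); first by apply/andP; split; lra.
rewrite (_ : x + (t + u) * g = x + t * g + u * g); last by ring.
rewrite expr2 mulrA -Hu -Ht (_ : x + 2 * g = x + g + g); last by ring.
by ring.
Qed.

Lemma second_difference_cvg (f f1 f2 : R -> R) :
  (forall x : R, is_derive x 1 f (f1 x)) -> (forall x : R, is_derive x 1 f1 (f2 x)) ->
  forall x, {for x, continuous f2} ->
  (fun g => (f (x + 2 * g) - 2 * f (x + g) + f x) / g ^+ 2) @ 0^'+ --> f2 x.
Proof.
move=> df df1 x cf2; apply/cvgrPdist_lt => e e0.
have /cvgrPdist_lt/(_ _ e0) := cf2.
move=> /nbhs_ballP[r /= r0 rP].
near=> g.
have g0 : 0 < g by near: g; exact: nbhs_right_gt.
have gr : g < r / 2 by near: g; apply: nbhs_right_lt; rewrite divr_gt0.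
have [t /andP[t0 t2] ->] := second_difference df df1 x g.
rewrite mulfK ?expf_neq0 ?gt_eqF//; apply: rP => /=.
rewrite /ball/= opprD addrA subrr sub0r normrN ger0_norm; last by rewrite mulr_ge0// ltW.
have : t * g <= 2 * g by rewrite ler_pM2r.
by move=> ?; lra.
Unshelve. all: by end_near. Qed.

End mean_value.

(** * The centred moment generating function *)

Section cumulant.
Context (R : realType) (b k : R -> R)
  (mu : {measure set (measurableTypeR R) -> \bar R}) (Dom : set R).
Hypothesis family : glm_family b k mu Dom.

Local Notation b1 := (derive1n 1 b).
Local Notation V := (derive1n 2 b).

Lemma is_derive_cumulant (i : nat) (x : R) : (i < 3)%N ->
  is_derive x 1 (derive1n i b) (derive1n i.+1 b x).
Proof.
move=> i3; case: family => -[_ /(_ i x i3) db] _ _ _.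
by rewrite derive1nS derive1E; exact/derivableP.
Qed.

Lemma continuous_cumulant (i : nat) : (i < 3)%N -> continuous (derive1n i b).
Proof.
move=> i3 x; apply/differentiable_continuous/derivable1_diffP.
by case: (is_derive_cumulant x i3).
Qed.

(** The moment generating function of [Y - b' eta] for a response [Y] of linear
    predictor [eta], followed by its first two derivatives; [mgf2 eta 0] is the
    variance [b'' eta]. *)
Definition mgf (eta t : R) := expR (b (eta + t) - b eta - b1 eta * t).
Definition mgf1 (eta t : R) := (b1 (eta + t) - b1 eta) * mgf eta t.
Definition mgf2 (eta t : R) :=
  (V (eta + t) + (b1 (eta + t) - b1 eta) ^+ 2) * mgf eta t.

Lemma is_derive_addl (f df : R -> R) (eta : R) :
  (forall x : R, is_derive x 1 f (df x)) ->
  forall t : R, is_derive t 1 (fun t => f (eta + t)) (df (eta + t)).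
Proof.
move=> fdf t; have shift : is_derive t 1 (fun t => eta + t) 1.
  by apply: (is_derive_eq (is_deriveD (is_derive_cst eta t 1) (is_derive_id t 1)));
    rewrite add0r.
by rewrite -[df _]mulr1; exact: (@is_derive1_comp R f (fun t => eta + t)).
Qed.

Lemma is_derive_mgf (eta t : R) : is_derive t 1 (mgf eta) (mgf1 eta t).
Proof.
have db : is_derive t 1 (fun t => b (eta + t)) (b1 (eta + t)).
  by apply: is_derive_addl => x; exact: (@is_derive_cumulant 0).
have dl : is_derive t 1 (fun t => b1 eta * t) (b1 eta).
  by apply: (is_derive_eq (is_deriveZ (b1 eta) (is_derive_id t 1))); exact: mulr1.
have dm : is_derive t 1 (fun t => b (eta + t) - b eta - b1 eta * t)
    (b1 (eta + t) - b1 eta).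
  apply: (is_derive_eq (is_deriveB (is_deriveB db (is_derive_cst (b eta) t 1)) dl)).
  by rewrite subr0.
rewrite /mgf1 mulrC.
exact: (@is_derive1_comp R expR (fun t => b (eta + t) - b eta - b1 eta * t)).
Qed.

Lemma is_derive_mgf1 (eta t : R) : is_derive t 1 (mgf1 eta) (mgf2 eta t).
Proof.
have db : is_derive t 1 (fun t => b1 (eta + t)) (V (eta + t)).
  by apply: is_derive_addl => x; exact: (@is_derive_cumulant 1).
have db' : is_derive t 1 (fun t => b1 (eta + t) - b1 eta) (V (eta + t)).
  apply: (is_derive_eq (is_deriveB db (is_derive_cst (b1 eta) t 1))).
  by rewrite subr0.
apply: (is_derive_eq (is_deriveM db' (is_derive_mgf eta t))).
by rewrite /mgf2 /mgf1 /GRing.scale/=; ring.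
Qed.

Lemma continuous_mgf2 (eta : R) : continuous (mgf2 eta).
Proof.
have cadd (f : R -> R) : continuous f -> continuous (fun t => f (eta + t)).
  move=> cf t; apply: (@continuous_comp _ _ _ (fun t => eta + t) f); last exact: cf.
  by apply: continuousD => //; exact: cst_continuous.
have cV := cadd V (@continuous_cumulant 2 isT).
have cb1 := cadd b1 (@continuous_cumulant 1 isT).
move=> t; apply: cvgM; last first.
  apply/differentiable_continuous/derivable1_diffP.
  by case: (is_derive_mgf eta t).
apply: cvgD; first exact: cV.
by apply: cvgM; apply: cvgB; [exact: cb1|exact: cvg_cst|exact: cb1|exact: cvg_cst].
Qed.

(** The positivity of [laplace_positive] after tilting by [expR (eta y)] and
    centring at [b' eta]. *)
Lemma mgf_positive (eta : R) (l : seq (R * R)) :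
  (forall y, 0 <= \sum_(q <- l) q.1 * expR (q.2 * y)) ->
  0 <= \sum_(q <- l) q.1 * mgf eta q.2.
Proof.
move=> l0.
have := @laplace_positive _ _ _ _ _ family
  [seq (q.1 * expR (- b eta - b1 eta * q.2), eta + q.2) | q <- l].
rewrite !big_map/= => H.
rewrite (eq_bigr (fun q => q.1 * expR (- b eta - b1 eta * q.2) *
   expR (b (eta + q.2)))); last first.
  by move=> q _; rewrite -mulrA -expRD /mgf; congr (_ * expR _); ring.
apply: H => y; rewrite big_map/=.
rewrite (eq_bigr (fun q => expR (eta * y - b eta) *
   (q.1 * expR (q.2 * (y - b1 eta))))) => [|q _].
  by rewrite -mulr_sumr mulr_ge0 ?expR_ge0.
rewrite -mulrA [RHS]mulrCA -!expRD; congr (_ * expR _).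
by ring.
Qed.

End cumulant.

(** * Regularity of the variance function *)

Lemma expRB1_le (R : realType) (x : R) : `|expR x - 1| <= `|x| * expR `|x|.
Proof.
have := expR_ge1Dx x; have := expR_ge1Dx (- x).
rewrite expRN => H1 H2.
have e0 := expR_gt0 x.
have H3 : (1 - x) * expR x <= 1.
  by rewrite -ler_pdivlMr// mul1r; lra.
have [x0|x0] := leP 0 x.
  rewrite ger0_norm; last by lra.
  by rewrite ger0_norm//; lra.
have e1 : 1 <= expR (- x) by rewrite -expR0 ler_expR; lra.
have e2 : expR x <= 1 by rewrite -expR0 ler_expR ltW.
rewrite ler0_norm ?(ltr0_norm x0); last by lra.
rewrite opprB; apply: (@le_trans _ _ (- x * 1)); first by lra.
by rewrite ler_wpM2l//; lra.
Qed.

Lemma expRB1_le_sym (R : realType) (s h y : R) : 0 < s -> `|h| <= s / 2 ->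
  `|expR (h * y) - 1| <= 2 * `|h| / s * (expR (s * y) + expR (- s * y)).
Proof.
move=> s0 hs; apply: le_trans (expRB1_le _) _; rewrite normrM.
have sy : expR `|s * y| <= expR (s * y) + expR (- s * y).
  rewrite mulNr; have := expR_ge0 (s * y); have := expR_ge0 (- (s * y)).
  by case: (leP 0 (s * y)) => ?; [rewrite ger0_norm//|rewrite ltr0_norm//]; lra.
apply: (@le_trans _ _ (2 * `|h| / s * expR `|s * y|)); last first.
  by rewrite ler_wpM2l// divr_ge0 ?mulr_ge0// ltW.
rewrite normrM (gtr0_norm s0); set z := `|y|; set a := `|h|.
have z0 : 0 <= z := normr_ge0 y; have a0 : 0 <= a := normr_ge0 h.
have E : expR (s * z) = expR (s * z / 2) * expR (s * z / 2).
  by rewrite -expRD; congr expR; lra.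
have H1 : expR (a * z) <= expR (s * z / 2).
  by rewrite ler_expR mulrAC ler_wpM2r.
have H2 : s * z / 2 <= expR (s * z / 2).
  by have := expR_ge1Dx (s * z / 2); lra.
rewrite E; apply: (@le_trans _ _ (a * z * expR (s * z / 2))).
  by rewrite ler_wpM2l// mulr_ge0.
rewrite mulrA ler_wpM2r ?expR_ge0//.
rewrite (_ : a * z = 2 * a / s * (s * z / 2)); last by field; rewrite gt_eqF.
by rewrite ler_wpM2l// divr_ge0 ?mulr_ge0// ltW.
Qed.

Section variance_function.
Context (R : realType) (b k : R -> R)
  (mu : {measure set (measurableTypeR R) -> \bar R}) (Dom : set R).
Hypothesis family : glm_family b k mu Dom.

Local Notation b1 := (derive1n 1 b).
Local Notation V := (derive1n 2 b).

Let D2 (eta g t : R) := mgf b eta (t + 2 * g) - 2 * mgf b eta (t + g) + mgf b eta t.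

Let D2_cvg (eta t : R) : (fun g => D2 eta g t / g ^+ 2) @ 0^'+ --> mgf2 b eta t.
Proof.
have H := second_difference_cvg (is_derive_mgf family eta) (is_derive_mgf1 family eta).
by apply: H; exact: (continuous_mgf2 family).
Qed.

Let D2_seq (c g t : R) := [:: (c, t + 2 * g); (- (2 * c), t + g); (c, t)].

Let sum_D2_mgf (eta c g t : R) :
  \sum_(q <- D2_seq c g t) q.1 * mgf b eta q.2 = c * D2 eta g t.
Proof. by rewrite !big_cons big_nil /D2 /=; ring. Qed.

Let sum_D2_expR (c g t y : R) : \sum_(q <- D2_seq c g t) q.1 * expR (q.2 * y) =
  c * expR (t * y) * (expR (g * y) - 1) ^+ 2.
Proof.
have E1 : expR ((t + g) * y) = expR (t * y) * expR (g * y).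
  by rewrite -expRD; congr expR; ring.
have E2 : expR ((t + 2 * g) * y) = expR (t * y) * expR (g * y) ^+ 2.
  by rewrite expr2 -!expRD; congr expR; ring.
by rewrite !big_cons big_nil /= E1 E2; ring.
Qed.

Let cvg_right_ge0 (F : R -> R) (l : R) : F @ 0^'+ --> l ->
  (forall g, 0 < g -> 0 <= F g) -> 0 <= l.
Proof.
move=> cF F0; rewrite -(cvg_lim _ cF)//; apply: limr_ge; first exact: cvgP cF.
by near=> g; apply: F0; near: g; exact: nbhs_right_gt.
Unshelve. all: by end_near. Qed.

(** The second difference of [mgf x] at 0 is the expectation of
    [(expR (g eps) - 1) ^ 2]. *)
Lemma b2_ge0 (x : R) : 0 <= V x.
Proof.
have -> : V x = mgf2 b x 0.
  by rewrite /mgf2 addr0 !subrr expr0n/= addr0 /mgf addr0 subrr mulr0 subr0 expR0 mulr1.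
apply: (cvg_right_ge0 (@D2_cvg x 0)) => g g0; rewrite divr_ge0 ?sqr_ge0//.
rewrite -[D2 _ _ _]mul1r -sum_D2_mgf; apply: (mgf_positive family) => y.
by rewrite sum_D2_expR mul1r mulr_ge0 ?expR_ge0 ?sqr_ge0.
Qed.

(** [mgf2] is the expectation of [eps^2 expR (t eps)]; its increments between 0 and
    [h] are controlled by its values at [s] and [- s] because
    [expRB1_le_sym] bounds [expR (h eps) - 1] pointwise.  The weight [eps^2] is
    obtained as the limit of [((expR (g eps) - 1) / g) ^ 2]. *)
Lemma mgf2_lipschitz (eta s h : R) : 0 < s -> `|h| <= s / 2 ->
  `|mgf2 b eta h - mgf2 b eta 0| <=
    2 * `|h| / s * (mgf2 b eta s + mgf2 b eta (- s)).
Proof.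
move=> s0 hs; set kap := 2 * `|h| / s.
have half (e : R) : `|e| <= 1 -> e * (mgf2 b eta h - mgf2 b eta 0) <=
    kap * (mgf2 b eta s + mgf2 b eta (- s)).
  move=> e1.
  rewrite -subr_ge0; pose G t g := D2 eta g t / g ^+ 2.
  have cv : (fun g => kap * (G s g + G (- s) g) - e * (G h g - G 0 g)) @ 0^'+ -->
      kap * (mgf2 b eta s + mgf2 b eta (- s)) - e * (mgf2 b eta h - mgf2 b eta 0).
    apply: cvgB; (apply: cvgM; first exact: cvg_cst).
      by apply: cvgD; exact: D2_cvg.
    by apply: cvgB; exact: D2_cvg.
  apply: (cvg_right_ge0 cv) => g g0.
  rewrite /G -mulrDl -mulrBl !mulrA -mulrBl divr_ge0 ?sqr_ge0//.
  pose l := D2_seq kap g s ++ D2_seq kap g (- s)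
    ++ D2_seq (- e) g h ++ D2_seq e g 0.
  suff : 0 <= \sum_(q <- l) q.1 * mgf b eta q.2.
    by rewrite !big_cat !sum_D2_mgf/=; lra.
  apply: (mgf_positive family) => y.
  rewrite !big_cat !sum_D2_expR/= -!mulrDl mulr_ge0 ?sqr_ge0//.
  rewrite mul0r expR0 mulr1.
  have := expRB1_le_sym y s0 hs; rewrite -/kap => H.
  have : e * (expR (h * y) - 1) <= `|expR (h * y) - 1|.
    by rewrite (le_trans (ler_norm _))// normrM ler_piMl.
  lra.
rewrite ler_norml; have := half 1; have := half (- 1).
rewrite normrN normr1 => /(_ (lexx _)) ? /(_ (lexx _)) ?.
by apply/andP; split; lra.
Qed.
End variance_function.

(** * Bernstein-type bounds under slow variation of the variance *)

Section slowly_varying_variance.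
Context (R : realType) (b k : R -> R)
  (mu : {measure set (measurableTypeR R) -> \bar R}) (Dom : set R).
Hypothesis family : glm_family b k mu Dom.
Context (C : R).
Hypothesis C1 : 1 <= C.
Hypothesis devC : forall x y : R, `|y| <= 2^-1 ->
  derive1n 2 b (x + y) <= C * derive1n 2 b x.

Local Notation b1 := (derive1n 1 b).
Local Notation V := (derive1n 2 b).

Let V0 (x : R) : 0 <= V x. Proof. exact: (b2_ge0 family). Qed.
Let db (x : R) : is_derive x 1 b (b1 x). Proof. exact: (@is_derive_cumulant _ _ _ _ _ family 0). Qed.
Let db1 (x : R) : is_derive x 1 b1 (V x). Proof. exact: (@is_derive_cumulant _ _ _ _ _ family 1). Qed.

Let norm_ray (t d : R) : 0 <= t <= 1 -> `|t * d| <= `|d|.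
Proof. by move=> /andP[t0 t1]; rewrite normrM (ger0_norm t0) ler_piMl. Qed.

Lemma score_increment_le (x d : R) : `|d| <= 2^-1 ->
  `|b1 (x + d) - b1 x| <= C * V x * `|d|.
Proof.
move=> d2; have [t t01 ->] := MVT_ray db1 x d.
rewrite normrM (ger0_norm (V0 _)) ler_wpM2r//; apply: devC.
exact: le_trans (norm_ray d t01) d2.
Qed.

Lemma bregman_le (x d : R) : `|d| <= 2^-1 ->
  `|b (x + d) - b x - b1 x * d| <= C * V x * d ^+ 2.
Proof.
move=> d2; have [t t01 ->] := MVT_ray db x d.
rewrite -mulrBl normrM -real_normK ?num_real// expr2 mulrA ler_wpM2r//.
have td := norm_ray d t01.
apply: le_trans (score_increment_le _ (le_trans td d2)) _.
by rewrite ler_wpM2l// mulr_ge0// (le_trans _ C1).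
Qed.

Lemma bregman_ge (x d : R) : `|d| <= 2^-1 ->
  V x / (2 * C) * d ^+ 2 <= b (x + d) - b x - b1 x * d.
Proof.
move=> d2; set a := V x / (2 * C).
have C0 : 0 < C by apply: lt_le_trans C1.
have dg (t : R) : is_derive t 1 (fun t => b (x + t) - b1 x * t - a * (t * t))
    (b1 (x + t) - b1 x - a * (t + t)).
  have dbx := is_derive_addl x db t.
  have dl : is_derive t 1 (fun t => b1 x * t) (b1 x).
    by apply: (is_derive_eq (is_deriveZ (b1 x) (is_derive_id t 1))); exact: mulr1.
  have dq : is_derive t 1 (fun t => a * (t * t)) (a * (t + t)).
    apply: (is_derive_eq (is_deriveZ a (is_deriveM (is_derive_id t 1) (is_derive_id t 1)))).
    by rewrite /GRing.scale/= mulr1.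
  exact: (is_deriveB (is_deriveB dbx dl) dq).
have [t t01] := MVT_ray dg 0 d.
rewrite !(add0r, addr0, mulr0, subr0) => H.
(* The derivative of the difference of both sides has the sign of t * d. *)
suff : 0 <= (b1 (x + t * d) - b1 x - a * (t * d + t * d)) * d.
  by rewrite -H expr2; lra.
have [u u01 ->] := MVT_ray db1 x (t * d).
have utd : `|u * (t * d)| <= 2^-1.
  exact: le_trans (norm_ray _ u01) (le_trans (norm_ray _ t01) d2).
have VC : V x <= C * V (x + u * (t * d)).
  by have := @devC (x + u * (t * d)) (- (u * (t * d))); rewrite normrN addrK; exact.
rewrite (_ : _ * d = 2 * t * (V (x + u * (t * d)) / 2 - a) * d ^+ 2); last by field.
apply: mulr_ge0; last exact: sqr_ge0.
apply: mulr_ge0; first by case/andP: t01 => t0 _; rewrite mulr_ge0.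
rewrite subr_ge0 /a ler_pdivrMr ?mulr_gt0//; move: VC; set v' := V (_ + _).
by rewrite (_ : v' / 2 * (2 * C) = C * v')//; field.
Qed.

Lemma mgf_le (x d : R) : `|d| <= 2^-1 -> mgf b x d <= expR (C * V x * d ^+ 2).
Proof.
by move=> d2; rewrite ler_expR (le_trans (ler_norm _))// bregman_le.
Qed.

(** The terms come from the increments of [mgf1], from [mgf - 1], and from the first
    order bound at distance at least [s / 2] from the base point, in the proof of
    [score_remainder_le]. *)
Definition remainder_const : R :=
  4 * (C + C ^+ 2) * expR C + C ^+ 2 * expR C + 2 * (C + 1).

(** The hypothesis on [b''] allows oscillations at any scale, so the increments of
    [b''] are bounded through [mgf2] instead.  On an interval of radius
    [s = (2 + sqrt (b'' x))^-1] both [mgf] and [mgf2 / b'' x] are bounded, and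
    [mgf2_lipschitz] loses a factor [1 / s]; this gives the quadratic bound for
    [|d| <= s / 2].  For larger [d] the bound is weaker than the first order
    one. *)
Lemma score_remainder_le (x d : R) : `|d| <= 2^-1 ->
  `|b1 (x + d) - b1 x - V x * d| <=
    remainder_const * (V x * (2 + Num.sqrt (V x))) * d ^+ 2.
Proof.
move=> d2; set v := V x; set w := Num.sqrt v; set psi := b1 (x + d) - b1 x.
have v0 : 0 <= v := V0 x. have w0 : 0 <= w := sqrtr_ge0 v.
have vw : v = w * w by rewrite -expr2 sqr_sqrtr.
have C0 : 0 < C by apply: lt_le_trans C1.
set s := (2 + w)^-1.
have s0 : 0 < s by rewrite invr_gt0; lra.
have sw : s * (2 + w) = 1 by rewrite /s mulVf// gt_eqF//; lra.
have s2 : s <= 2^-1 by rewrite /s lef_pV2 ?posrE; lra.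
have sw1 : s * w <= 1 by nra.
have vs1 : v * s ^+ 2 <= 1.
  rewrite vw (_ : w * w * s ^+ 2 = (s * w) ^+ 2); last by ring.
  by rewrite expr_le1// mulr_ge0// ltW.
have eC1 : 1 <= expR C by rewrite -expR0 ler_expR ltW.
have psid : `|psi| <= C * v * `|d| by exact: score_increment_le.
have dd : d ^+ 2 = `|d| * `|d| by rewrite -expr2 real_normK// num_real.
have Ci : 0 <= C := ltW C0.
have K10 : 0 <= (C + C ^+ 2) * expR C.
  by rewrite mulr_ge0 ?expR_ge0// addr_ge0// exprn_ge0.
have K20 : 0 <= C ^+ 2 * expR C by rewrite mulr_ge0 ?expR_ge0// exprn_ge0.
have ad0 : 0 <= `|d| := normr_ge0 d.
have w20 : 0 <= 2 + w by rewrite addr_ge0.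
have tri : `|psi - v * d| <= (C + 1) * v * `|d|.
  rewrite (le_trans (ler_normB _ _))// normrM (ger0_norm v0).
  by rewrite !mulrDl mul1r lerD2r.
have [ds|ds] := leP `|d| (s / 2); last first.
  apply: le_trans tri _.
  have d1 : 1 <= 2 * `|d| * (2 + w).
    have : (s / 2) * (2 + w) <= `|d| * (2 + w) by rewrite ler_wpM2r// ltW.
    by rewrite mulrAC sw mul1r -mulrA; lra.
  apply: (@le_trans _ _ (2 * (C + 1) * (v * (2 + w)) * d ^+ 2)).
    rewrite dd (_ : 2 * (C + 1) * (v * (2 + w)) * (`|d| * `|d|) =
      (C + 1) * v * `|d| * (2 * `|d| * (2 + w))); last by ring.
    by rewrite ler_peMr// !mulr_ge0// addr_ge0.
  rewrite ler_wpM2r ?sqr_ge0// ler_wpM2r ?mulr_ge0// /remainder_const.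
  by rewrite lerDr addr_ge0// -mulrA mulr_ge0.
have vds : v * d ^+ 2 <= 1.
  apply: le_trans vs1; rewrite ler_wpM2l// -real_normK ?num_real//.
  rewrite lerXn2r ?nnegrE ?(ltW s0)//; apply: le_trans ds _.
  by rewrite ler_pdivrMr// ler_peMr ?ltW// ltrDl.
have mgf2_s (e : R) : `|e| = s -> mgf2 b x e <= (C + C ^+ 2) * expR C * v.
  move=> es; have e2 : `|e| <= 2^-1 by rewrite es.
  have ee : e ^+ 2 = s ^+ 2 by rewrite -es real_normK// num_real.
  rewrite /mgf2 mulrAC; apply: ler_pM; rewrite ?expR_ge0//.
  - by apply: addr_ge0; [exact: V0|exact: sqr_ge0].
  - rewrite mulrDl lerD ?devC//.
    have H := score_increment_le x e2.
    rewrite -real_normK ?num_real//.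
    apply: (@le_trans _ _ ((C * v * `|e|) ^+ 2)).
      by rewrite lerXn2r ?nnegrE// !mulr_ge0.
    rewrite es (_ : _ ^+ 2 = C ^+ 2 * v * (v * s ^+ 2)); last by ring.
    by rewrite ler_piMr// mulr_ge0// exprn_ge0.
  - apply: le_trans (mgf_le x e2) _; rewrite ler_expR ee -mulrA.
    by rewrite ler_piMr.
have mgf1_d : `|mgf1 b x d - v * d| <= 4 * ((C + C ^+ 2) * expR C) * v * (2 + w) * d ^+ 2.
  have dG (t : R) : is_derive t 1 (fun t => mgf1 b x t - v * t) (mgf2 b x t - v).
    have dl : is_derive t 1 (fun t => v * t) v.
      by apply: (is_derive_eq (is_deriveZ v (is_derive_id t 1))); exact: mulr1.
    exact: (is_deriveB (is_derive_mgf1 family x t) dl).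
  have [t t01] := MVT_ray dG 0 d.
  have -> : mgf1 b x 0 = 0 by rewrite /mgf1 addr0 subrr mul0r.
  rewrite !(add0r, mulr0, subr0, oppr0) => ->.
  have td : `|t * d| <= s / 2 := le_trans (norm_ray d t01) ds.
  have mgf2_0 : mgf2 b x 0 = v.
    by rewrite /mgf2 addr0 !subrr expr0n/= addr0 /mgf addr0 subrr mulr0 subr0 expR0 mulr1.
  have H := mgf2_lipschitz family x s0 td; rewrite mgf2_0 in H.
  rewrite normrM dd [leRHS]mulrA ler_wpM2r//; apply: le_trans H _.
  have Hs := mgf2_s s (gtr0_norm s0).
  have Hn : mgf2 b x (- s) <= (C + C ^+ 2) * expR C * v.
    by apply: mgf2_s; rewrite normrN gtr0_norm.
  have tdd := norm_ray d t01.
  rewrite -/s (_ : 4 * _ * v * (2 + w) * `|d| = 2 * `|d| * (2 + w) *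
    (2 * ((C + C ^+ 2) * expR C * v))); last by ring.
  have -> : 2 * `|t * d| / s = 2 * `|t * d| * (2 + w) by rewrite /s invrK.
  apply: ler_pM.
  - by rewrite !mulr_ge0.
  - by apply: addr_ge0; (apply: mulr_ge0; last exact: expR_ge0);
      (apply: addr_ge0; [exact: V0|exact: sqr_ge0]).
  - by rewrite ler_wpM2r// ler_wpM2l.
  - lra.
have mgf_1 : `|mgf b x d - 1| <= C * v * d ^+ 2 * expR C.
  have H := bregman_le x d2.
  apply: le_trans (expRB1_le _) _.
  apply: ler_pM; rewrite ?expR_ge0// ler_expR (le_trans H)// -mulrA.
  by rewrite ler_piMr.
have vd : v * `|d| <= 2 + w.
  have ds' : `|d| <= s by apply: le_trans ds _; lra.
  have vs : v * s <= w.
    by rewrite vw -mulrA (mulrC w s) ler_piMr.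
  have : v * `|d| <= v * s by rewrite ler_wpM2l.
  by lra.
(* mgf1 = psi * mgf, so psi differs from mgf1 by (mgf - 1) * psi. *)
rewrite (_ : psi - v * d = (mgf1 b x d - v * d) - (mgf b x d - 1) * psi); last first.
  by rewrite /mgf1 -/psi; ring.
apply: le_trans (ler_normB _ _) _; rewrite (normrM (_ - 1)).
have H2 : `|mgf b x d - 1| * `|psi| <= C ^+ 2 * expR C * (v * (2 + w)) * d ^+ 2.
  apply: (@le_trans _ _ ((C * v * d ^+ 2 * expR C) * (C * v * `|d|))).
    by apply: ler_pM.
  rewrite (_ : _ * (C * v * `|d|) = C ^+ 2 * expR C * (v * d ^+ 2) * (v * `|d|)); last by ring.
  rewrite (_ : C ^+ 2 * expR C * (v * (2 + w)) * d ^+ 2 =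
    C ^+ 2 * expR C * (v * d ^+ 2) * (2 + w)); last by ring.
  by rewrite ler_wpM2l// mulr_ge0// mulr_ge0 ?sqr_ge0.
apply: le_trans (lerD mgf1_d H2) _.
rewrite -subr_ge0 (_ : _ - _ = 2 * (C + 1) * (v * (2 + w) * d ^+ 2)); last first.
  by rewrite /remainder_const; ring.
apply: mulr_ge0; first by rewrite mulr_ge0// addr_ge0.
by apply: mulr_ge0; [exact: mulr_ge0|exact: sqr_ge0].
Qed.

End slowly_varying_variance.

Lemma remainder_const_ge0 (R : realType) (C : R) : 0 <= C -> 0 <= remainder_const C.
Proof.
move=> C0; have e0 := expR_ge0 C.
by rewrite /remainder_const !addr_ge0 ?mulr_ge0 ?addr_ge0 ?exprn_ge0.
Qed.

(** * Exponential moments and tails of the noise *)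

Section response.
Context (R : realType) (b k : R -> R)
  (mu : {measure set (measurableTypeR R) -> \bar R}) (Dom : set R).
Hypothesis family : glm_family b k mu Dom.
Context d (T : measurableType d) (P : probability T R).

Definition glm_response (eta : R) (Y : {RV P >-> R}) : Prop :=
  forall B : set (measurableTypeR R), measurable B ->
    distribution P Y B =
    (\int[mu]_(y in B `&` Dom) (glm_density b k eta y)%:E)%E.

Lemma integral_response (eta : R) (Y : {RV P >-> R}) (f : R -> R) :
  glm_response eta Y -> measurable_fun [set: R] f -> (forall y, 0 <= f y) ->
  (\int[P]_w (f (Y w))%:E =
   \int[mu]_(y in Dom) (glm_density b k eta y * f y)%:E)%E.
Proof.
move=> HY mf f0.
have mD := measurable_response_set family.
rewrite -(@ge0_integral_distribution _ _ _ _ _ P Y (EFin \o f)); last 2 first.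
- exact/measurable_EFinP.
- by move=> y; rewrite lee_fin.
rewrite (@ge0_integral_density _ _ _ _ _ mu (distribution P Y) Dom
   (glm_density b k eta) id 1)//.
- by rewrite mul1e.
- exact: (measurable_glm_density family).
- by move=> y; exact: expR_ge0.
move=> B mB; rewrite mul1e; apply: etrans (esym (HY B mB)).
rewrite setIC integral_mkcondr.
apply: eq_integral => y _.
rewrite /patch indicE; case: ifP => _; by rewrite ?mulr1 ?mulr0.
Qed.

Lemma integral_expR_response (eta c t : R) (Y : {RV P >-> R}) :
  glm_response eta Y ->
  (\int[P]_w (expR (t * (Y w - c)))%:E =
   (expR (b (eta + t) - b eta - c * t))%:E)%E.
Proof.
move=> HY.
have mD := measurable_response_set family.
rewrite (@integral_response eta Y (fun y => expR (t * (y - c))))//; last first.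
  by apply: measurableT_comp => //; apply: measurable_funM => //; exact: measurable_funB.
under eq_integral => y _.
  rewrite (_ : _ * _ = expR (b (eta + t) - b eta - c * t) *
     glm_density b k (eta + t) y); last first.
    by rewrite /glm_density -!expRD; congr expR; ring.
  rewrite EFinM; over.
rewrite (integralZl mD (integrable_glm_density family (eta + t))).
by case: family => _ _ _ ->; rewrite mule1.
Qed.

(** [|y| <= expR y + expR (- y)], and exponential moments are finite. *)
Lemma integrable_response (eta : R) (Y : {RV P >-> R}) : glm_response eta Y ->
  P.-integrable [set: T] (fun w => (Y w)%:E).
Proof.
move=> HY.
have me t : measurable_fun [set: T] (fun w => expR (t * (Y w - 0))).
  apply: measurableT_comp => //; apply: measurable_funM => //.
  exact: measurable_funB.
have ie t : P.-integrable [set: T] (fun w => (expR (t * (Y w - 0)))%:E).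
  apply/integrableP; split; first exact/measurable_EFinP.
  under eq_integral => w _ do rewrite /= ger0_norm ?expR_ge0//.
  by rewrite (integral_expR_response 0 t HY) ltry.
apply: (@le_integrable _ _ _ _ _ measurableT _
   (fun w => (expR (1 * (Y w - 0)))%:E + (expR (-1 * (Y w - 0)))%:E)%E) => //.
- exact/measurable_EFinP.
- move=> w _; rewrite -EFinD !abse_EFin lee_fin !subr0 mul1r mulN1r.
  rewrite [leRHS]ger0_norm ?addr_ge0 ?expR_ge0//.
  have := expR_ge1Dx (Y w); have := expR_ge1Dx (- Y w).
  have := expR_ge0 (Y w); have := expR_ge0 (- Y w).
  by rewrite ler_norml => ? ? ? ?; apply/andP; split; lra.
- exact: integrableD.
Qed.

End response.

Section chernoff_bound.
Context (R : realType) (b k : R -> R)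
  (mu : {measure set (measurableTypeR R) -> \bar R}) (Dom : set R).
Hypothesis family : glm_family b k mu Dom.
Context (C : R).
Hypothesis C1 : 1 <= C.
Hypothesis devC : forall x y : R, `|y| <= 2^-1 ->
  derive1n 2 b (x + y) <= C * derive1n 2 b x.
Context d (T : measurableType d) (P : probability T R)
  (n : nat) (Y : 'I_n -> {RV P >-> R}) (eta : 'I_n -> R).
Hypothesis indY : mutually_independent Y.
Hypothesis HY : forall i, glm_response b k mu Dom (eta i) (Y i).

Local Notation b1 := (derive1n 1 b).
Local Notation V := (derive1n 2 b).

Definition noise (i : 'I_n) (w : T) : R := Y i w - b1 (eta i).

Lemma measurable_noise_sum (a : 'I_n -> R) :
  measurable_fun [set: T] (fun w => \sum_i a i * noise i w).
Proof.
apply: measurable_sum => i; apply: measurable_funM => //.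
exact: measurable_funB.
Qed.

(** Chernoff's bound, with the free parameter absorbed into the coefficients
    [a]. *)
Lemma noise_sum_tail (a : 'I_n -> R) (tau : R) : (forall i, `|a i| <= 2^-1) ->
  (P [set w | (tau <= \sum_i a i * noise i w)%R] <=
   (expR (C * (\sum_i V (eta i) * a i ^+ 2) - tau))%:E)%E.
Proof.
move=> a2; set A := [set w | _].
have mA : measurable A.
  rewrite (_ : A = [set: T] `&`
      (fun w => \sum_i a i * noise i w) @^-1` `[tau, +oo[%classic); last first.
    by rewrite setTI; apply/seteqP; split=> w; rewrite /A/= in_itv/= andbT.
  exact: measurable_noise_sum.
have E : (\int[P]_w (\prod_i expR (a i * (Y i w - b1 (eta i))))%:E =
    (\prod_i mgf b (eta i) (a i))%:E)%E.
  apply: (@integral_prod_independent _ _ _ _ _ Y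
     (fun i y => expR (a i * (y - b1 (eta i))))) => //.
  - move=> i; apply: measurableT_comp => //; apply: measurable_funM => //.
    exact: measurable_funB.
  - by move=> i; exact: expR_ge0.
  - by move=> i; exact: integral_expR_response (HY i).
have Ebound : \prod_i mgf b (eta i) (a i) <= expR (C * (\sum_i V (eta i) * a i ^+ 2)).
  rewrite mulr_sumr expR_sum; apply: ler_prod => i _.
  by rewrite expR_ge0 mulrA (mgf_le family C1 devC).
rewrite expRD expRN EFinM lee_pdivlMr ?expR_gt0//.
apply: (@le_trans _ _ (\prod_i mgf b (eta i) (a i))%:E); last by rewrite lee_fin.
rewrite -E -[A in P A]setIT -integral_indic// -ge0_integralZr//; last first.
  by apply/measurable_EFinP; exact: measurable_indic.
apply: ge0_le_integral => //.
- apply: emeasurable_funM; last exact: measurable_cst.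
  by apply/measurable_EFinP; exact: measurable_indic.
- apply/measurable_EFinP; apply: measurable_prod => i _.
  apply: measurableT_comp => //; apply: measurable_funM => //.
  exact: measurable_funB.
move=> w _; rewrite -EFinM lee_fin -expR_sum indicE.
case: (boolP (w \in A)) => [|_]; last by rewrite mul0r expR_ge0.
by rewrite inE mul1r ler_expR.
Qed.

End chernoff_bound.

(** * The maximiser of the expected likelihood *)

Section population_maximizer.
Context (R : realType) (b k : R -> R)
  (mu : {measure set (measurableTypeR R) -> \bar R}) (Dom : set R).
Hypothesis family : glm_family b k mu Dom.

(** The Kullback-Leibler inequality: [1 + z <= expR z] is integrated for the
    log-likelihood ratio [z], whose exponential has expectation 1. *)
Lemma mean_response_le d (T : measurableType d) (P : probability T R)
    (eta u : R) (Y : {RV P >-> R}) : glm_response b k mu Dom eta Y ->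
  u * fine (\int[P]_w (Y w)%:E)%E <= b (eta + u) - b eta.
Proof.
move=> HY; set c := b (eta + u) - b eta.
have iY := integrable_response family HY.
have ic r : P.-integrable [set: T] (fun=> r%:E).
  exact: finite_measure_integrable_cst.
have iuY : P.-integrable [set: T] (fun w => u%:E * (Y w)%:E)%E.
  exact: integrableZl.
have ie : P.-integrable [set: T] (fun w => (expR (u * (Y w - 0)))%:E).
  apply/integrableP; split.
    apply/measurable_EFinP; apply: measurableT_comp => //.
    by apply: measurable_funM => //; exact: measurable_funB.
  under eq_integral => w _ do rewrite /= ger0_norm ?expR_ge0//.
  by rewrite (integral_expR_response family 0 u HY) ltry.
have Ie : (\int[P]_w ((expR (- c))%:E * (expR (u * (Y w - 0)))%:E) = 1)%E.
  rewrite integralZl// (integral_expR_response family 0 u HY) -EFinM -expRD.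
  by rewrite mul0r subr0 addNr expR0.
have Il : (\int[P]_w (u%:E * (Y w)%:E + (1 - c)%:E) =
    (u * fine (\int[P]_w (Y w)%:E) + (1 - c))%:E)%E.
  rewrite (integralD measurableT iuY (ic (1 - c))) integralZl// integral_cst//=.
  rewrite probability_setT mule1.
  by rewrite [RHS]EFinD EFinM fineK// integrable_fin_num.
have : ((u * fine (\int[P]_w (Y w)%:E) + (1 - c))%:E <= 1)%E.
  rewrite -Il -Ie; apply: le_integral => //.
  - by apply: integrableD => //; exact: ic.
  - exact: integrableZl.
  move=> w _; rewrite -!EFinM -EFinD lee_fin -expRD subr0.
  by apply: le_trans (expR_ge1Dx _); lra.
by rewrite lee_fin; lra.
Qed.

Context (n : nat) (M : glm R n).
Hypothesis model : glm_model b k M mu Dom.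
Local Notation X := (design M).
Local Notation theta0 := (truth M).

Lemma model_response (i : 'I_n) :
  glm_response b k mu Dom ((X *m theta0) i 0) (resp M i).
Proof. by case: model => _ + _ => H B mB; exact: H. Qed.

Let mean (i : 'I_n) := fine (\int[prob M]_w (resp M i w)%:E)%E.
Let kmean (i : 'I_n) := fine (\int[prob M]_w (k (resp M i w))%:E)%E.

Lemma expectation_loglik m (Z : 'M[R]_(n, m)) (t : 'cV[R]_m) :
  ('E_(prob M)[fun w => loglik b k Z w t] =
   (\sum_i (mean i * (Z *m t) i 0 - b ((Z *m t) i 0) + kmean i))%:E)%E.
Proof.
rewrite unlock /loglik -sumEFin.
have iY i : (prob M).-integrable [set: Defs.space M]
    (fun w => (resp M i w)%:E * ((Z *m t) i 0)%:E)%E.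
  by apply: integrableZr => //; exact: (integrable_response family (model_response i)).
have ic r : (prob M).-integrable [set: Defs.space M] (fun=> r%:E).
  exact: finite_measure_integrable_cst.
have ik i : (prob M).-integrable [set: Defs.space M] (fun w => (k (resp M i w))%:E).
  by case: model.
under eq_integral => w _.
  rewrite -sumEFin.
  under eq_bigr do rewrite EFinD EFinB EFinM.
  over.
rewrite (integral_sum measurableT) => [|i]; last first.
  exact: (integrableD measurableT (integrableB measurableT (iY i) (ic _)) (ik i)).
apply: eq_bigr => i _.
rewrite (integralD measurableT (integrableB measurableT (iY i) (ic _)) (ik i)).
rewrite (integralB measurableT (iY i) (ic _)).
rewrite (integralZr measurableT (integrable_response family (model_response i))).
rewrite integral_cst//= probability_setT mule1 EFinD EFinB EFinM.
rewrite !fineK//; apply: integrable_fin_num => //.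
exact: (integrable_response family (model_response i)).
Qed.

(** The truth maximises term by term by [mean_response_le]; strict convexity of
    [b] and injectivity of the design exclude a second maximiser, whose midpoint
    with [t0] would do better. *)
Lemma theta_star_unique (S : {set 'I_(ncov M)}) (t0 : 'cV[R]_#|S|) :
  cols X S *m t0 = X *m theta0 ->
  (forall t : 'cV[R]_#|S|, cols X S *m t = 0 -> t = 0) ->
  theta_star b k S = t0.
Proof.
move=> Zt0 Zinj; set Z := cols X S in Zt0 Zinj *.
pose el (t : 'cV[R]_#|S|) :=
  \sum_i (mean i * (Z *m t) i 0 - b ((Z *m t) i 0) + kmean i).
rewrite /theta_star.
rewrite (_ : (fun t => _) = fun t => (el t)%:E); last first.
  by apply/funext => t; rewrite expectation_loglik.
have max0 u : el u <= el t0.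
  apply: ler_sum => i _; rewrite lerD2r Zt0.
  have := mean_response_le ((Z *m u) i 0 - (X *m theta0) i 0) (model_response i).
  by rewrite addrCA subrr addr0 mulrC mulrBr -/(mean i); lra.
have : is_argmax (fun t => (el t)%:E) (argmax (fun t => (el t)%:E)).
  apply: (@xgetPex _ _ [set t | is_argmax (fun t => (el t)%:E) t]).
  by exists t0 => u; rewrite lee_fin.
set t := argmax _ => tmax; move: (tmax (2^-1 *: t + (1 - 2^-1) *: t0)).
rewrite lee_fin leNgt => /negP nlt; apply/eqP/negP => /negP tt0.
apply: nlt.
have t_max : el t0 <= el t.
  by have := tmax t0; rewrite lee_fin.
have tE := max0 t.
rewrite [ltLHS](_ : _ = 2^-1 * el t + (1 - 2^-1) * el t0); last by lra.
have [i Zi] : exists i, (Z *m t) i 0 != (Z *m t0) i 0.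
  apply: contrapT => /forallNP H; move/eqP: tt0; apply; apply/eqP.
  rewrite -subr_eq0; apply/eqP/Zinj; rewrite mulmxBr; apply/eqP; rewrite subr_eq0.
  apply/eqP/matrixP => i j; rewrite ord1; apply/eqP.
  by apply: contrapT => /negP; exact: H.
have sc : strictly_convex b by case: family => -[].
rewrite /el !mulr_sumr -big_split/=.
have term j : 2^-1 * (mean j * (Z *m t) j 0 - b ((Z *m t) j 0) + kmean j) +
   (1 - 2^-1) * (mean j * (Z *m t0) j 0 - b ((Z *m t0) j 0) + kmean j) <=
   mean j * (Z *m (2^-1 *: t + (1 - 2^-1) *: t0)) j 0 -
   b ((Z *m (2^-1 *: t + (1 - 2^-1) *: t0)) j 0) + kmean j ?= iff
   ((Z *m t) j 0 == (Z *m t0) j 0).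
  rewrite mulmxDr -!scalemxAr !mxE; set x := \sum_ _ _; set y := \sum_ _ _.
  have [->|xy] := eqVneq x y.
    by split; last apply/eqP; rewrite (_ : 2^-1 * y + (1 - 2^-1) * y = y); lra.
  have := sc x y 2^-1 xy; rewrite invr_gt0 ltr0n invf_lt1// ltr1n => /(_ isT) H.
  by split; [|apply/negbTE; rewrite lt_eqF//]; lra.
have [le_el eq_el] := leif_sum (fun j (_ : predT j) => term j).
rewrite lt_neqAle eq_el le_el andbT.
by apply/forallPn; exists i.
Qed.
End population_maximizer.

(** * Quadratic forms and grids of directions *)

Section quadratic_forms.
Context (R : realType).

Lemma norm2_ge0 m (v : 'cV[R]_m) : 0 <= norm2 v.
Proof. exact: sqrtr_ge0. Qed.

Lemma sqr_norm2 m (v : 'cV[R]_m) : norm2 v ^+ 2 = \sum_i v i 0 ^+ 2.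
Proof. by rewrite sqr_sqrtr// sumr_ge0// => i _; exact: sqr_ge0. Qed.

Lemma trmx_mul_norm2 m (v : 'cV[R]_m) : (v^T *m v) 0 0 = norm2 v ^+ 2.
Proof. by rewrite sqr_norm2 mxE; apply: eq_bigr => i _; rewrite mxE expr2. Qed.

Lemma norm2_eq0 m (v : 'cV[R]_m) : (norm2 v == 0) = (v == 0).
Proof.
apply/eqP/eqP => [v0|->]; last first.
  by rewrite /norm2 big1 ?sqrtr0// => i _; rewrite mxE expr0n.
apply/matrixP => i j; rewrite ord1 mxE; apply/eqP.
rewrite -sqrf_eq0; apply/eqP; move: i isT; apply: psumr_eq0P.
  by move=> i _; exact: sqr_ge0.
by rewrite -sqr_norm2 v0 expr0n.
Qed.

Lemma entry_le_norm2 m (v : 'cV[R]_m) i : `|v i 0| <= norm2 v.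
Proof.
rewrite -(@ler_pXn2r _ 2)// ?nnegrE ?norm2_ge0// sqr_norm2 real_normK ?num_real//.
by rewrite (bigD1 i)//= lerDl sumr_ge0// => j _; exact: sqr_ge0.
Qed.

Lemma cauchy_schwarz m (u v : 'cV[R]_m) : (u^T *m v) 0 0 <= norm2 u * norm2 v.
Proof.
have [/eqP|u0] := eqVneq (norm2 u) 0.
  by rewrite norm2_eq0 => /eqP ->; rewrite trmx0 mul0mx mxE mulr_ge0// norm2_ge0.
have [/eqP|v0] := eqVneq (norm2 v) 0.
  by rewrite norm2_eq0 => /eqP ->; rewrite mulmx0 mxE mulr_ge0// norm2_ge0.
set a := norm2 u in u0 *; set c := norm2 v in v0 *.
have a0 : 0 < a by rewrite lt_neqAle eq_sym u0 norm2_ge0.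
have c0 : 0 < c by rewrite lt_neqAle eq_sym v0 norm2_ge0.
have : 0 <= \sum_i (c * u i 0 - a * v i 0) ^+ 2.
  by apply: sumr_ge0 => i _; exact: sqr_ge0.
have -> : \sum_i (c * u i 0 - a * v i 0) ^+ 2 =
    2 * (a * c) * (a * c - (u^T *m v) 0 0).
  rewrite mxE (eq_bigr (fun i => c ^+ 2 * u i 0 ^+ 2 + a ^+ 2 * v i 0 ^+ 2
    - 2 * (a * c) * (u^T 0 i * v i 0))); last by move=> i _; rewrite mxE; ring.
  rewrite sumrB big_split/= -!mulr_sumr -!sqr_norm2 -/a -/c; ring.
by rewrite pmulr_rge0 ?mulr_gt0// subr_ge0.
Qed.

(** Gram-Schmidt: while there are fewer than [m] columns in [B], some nonzero vector
    is orthogonal to them for [A], and it is normalised and appended. *)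
Lemma orthonormal_frame m (A : 'M[R]_m) : A^T = A ->
  (forall v : 'cV[R]_m, v != 0 -> 0 < (v^T *m A *m v) 0 0) ->
  exists B : 'M[R]_m, B^T *m A *m B = 1%:M.
Proof.
move=> symA posA.
suff H k : (k <= m)%N -> exists B : 'M[R]_(m, k), B^T *m A *m B = 1%:M by exact: H.
elim: k => [_|k IH km].
  by exists 0; apply/matrixP => -[].
have [B BAB] := IH (ltnW km).
have : kermx (A *m B) != 0.
  rewrite -mxrank_eq0 mxrank_ker -lt0n subn_gt0.
  exact: leq_ltn_trans (rank_leq_col _) km.
case/rowV0Pn => u /sub_kermxP uAB u0.
pose v := u^T.
have v0 : v != 0 by rewrite /v trmx_eq0.
have q0 := posA v v0; set q := (v^T *m A *m v) 0 0 in q0.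
have vAB : v^T *m A *m B = 0 by rewrite /v trmxK -mulmxA.
have BAv : B^T *m A *m v = 0.
  by apply: trmx_inj; rewrite trmx0 !trmx_mul (trmxK B) symA mulmxA vAB.
pose w := (Num.sqrt q)^-1 *: v.
rewrite -addn1.
exists (row_mx B w).
rewrite tr_row_mx mul_col_mx mul_col_row BAB scalar_mx_block.
rewrite -scalemxAr BAv scaler0 /w linearZ/= -!scalemxAl -scalemxAr vAB scaler0.
congr (block_mx _ _ _ _); rewrite scalerA -invfM -expr2 sqr_sqrtr ?ltW//.
apply/matrixP => i j; rewrite !ord1 mxE -/q [RHS]mxE mulVf//; exact: lt0r_neq0.
Qed.

Lemma frame_inv m (A B : 'M[R]_m) : B^T *m A *m B = 1%:M ->
  forall v : 'cV[R]_m, v = B *m (B^T *m A *m v).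
Proof. by move=> /mulmx1C BBA v; rewrite mulmxA BBA mul1mx. Qed.

(** The integer vectors with coordinates in [[- N, N]], as signs and absolute
    values, so that they are indexed by a finite type. *)
Definition grid_vector m N (c : {ffun 'I_m -> 'I_N.+1 * bool}) : 'cV[R]_m :=
  \col_i ((-1) ^+ (c i).2 * (c i).1%:R).

(** Rounding [2 m h / |h|] towards zero does not increase the norm and changes the
    product with [h] by at most the sum of the [|h i|], which is at most [m |h|].
    A direction that nearly attains the norm of [h] is thus found among
    [(4 m + 2) ^ m] candidates. *)
Lemma grid_direction m (h : 'cV[R]_m) : exists c : {ffun 'I_m -> 'I_(2 * m).+1 * bool},
  let z := grid_vector c in
  norm2 z <= (2 * m)%:R /\ m%:R * norm2 h <= (z^T *m h) 0 0.
Proof.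
have L0 := norm2_ge0 h; set L := norm2 h in L0 *.
have hL i : `|h i 0| <= L := entry_le_norm2 h i.
pose x i := (2 * m)%:R * (`|h i 0| / L).
have x0 i : 0 <= x i by rewrite mulr_ge0// divr_ge0.
have xN i : x i <= (2 * m)%:R.
  rewrite ler_piMr//; have [->|LN] := eqVneq L 0; first by rewrite invr0 mulr0.
  by rewrite ler_pdivrMr ?mul1r// lt_neqAle eq_sym LN.
have tN i : (Num.truncn (x i) < (2 * m).+1)%N.
  by rewrite ltnS -(ler_nat R); apply: le_trans (xN i); rewrite truncn_le.
exists [ffun i => (Ordinal (tN i), h i 0 < 0)] => z.
have zE i : z i 0 = (-1) ^+ (h i 0 < 0)%R * (Num.truncn (x i))%:R.
  by rewrite mxE ffunE.
have tx i : (Num.truncn (x i))%:R <= x i <= (Num.truncn (x i))%:R + 1.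
  by have /andP[H1 H2] := truncn_itv (x0 i); rewrite H1/= natr1 ltW.
split.
  rewrite -(@ler_pXn2r _ 2)// ?nnegrE ?norm2_ge0// sqr_norm2.
  apply: (@le_trans _ _ (\sum_i x i ^+ 2)).
    apply: ler_sum => i _; rewrite zE exprMn sqrr_sign mul1r.
    by rewrite lerXn2r ?nnegrE//; case/andP: (tx i).
  under eq_bigr do rewrite exprMn expr_div_n real_normK ?num_real//.
  rewrite -mulr_sumr -mulr_suml -sqr_norm2 -/L ler_piMr ?exprn_ge0//.
  have [->|LN] := eqVneq L 0; first by rewrite expr0n mul0r.
  by rewrite divff// expf_neq0.
rewrite mxE.
have [LE|LN] := eqVneq L 0.
  rewrite LE mulr0 sumr_ge0// => i _; rewrite mxE zE.
  have := hL i; rewrite LE normr_le0 => /eqP ->.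
  by rewrite mulr0.
have LP : 0 < L by rewrite lt_neqAle eq_sym LN.
have hh i : z^T 0 i * h i 0 >= (2 * m)%:R / L * h i 0 ^+ 2 - L.
  rewrite mxE zE [leRHS](_ : _ = (Num.truncn (x i))%:R * `|h i 0|); last first.
    case: (ltrP (h i 0) 0) => ?; [rewrite ltr0_norm//|rewrite ger0_norm//];
    rewrite /= ?expr1 ?expr0; ring.
  have /andP[_ H] := tx i.
  apply: (@le_trans _ _ ((x i - 1) * `|h i 0|)); last by rewrite ler_wpM2r// lerBlDr.
  rewrite mulrBl mul1r lerB//.
  rewrite (_ : x i * `|h i 0| = (2 * m)%:R / L * h i 0 ^+ 2)//.
  by rewrite -[in RHS]real_normK ?num_real// /x; field.
apply: le_trans (ler_sum _ (fun i _ => hh i)).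
rewrite sumrB -mulr_sumr -sqr_norm2 -/L sumr_const card_ord.
rewrite -[L *+ m]mulr_natl natrM expr2 mulrA divfK//.
lra.
Qed.

End quadratic_forms.

(** * Existence, localisation and expansion of the estimator *)

Lemma continuous_sum_fun (R : realType) (T : topologicalType) (I : Type)
    (s : seq I) (F : I -> T -> R) : (forall i, continuous (F i)) ->
  continuous (fun x => \sum_(i <- s) F i x).
Proof.
move=> cF; elim: s => [|i s IH] x.
  by under eq_fun do rewrite big_nil; exact: cvg_cst.
rewrite /continuous_at; under eq_fun do rewrite big_cons; rewrite big_cons.
by apply: cvgD; [exact: cF|exact: IH].
Qed.

Lemma mx_entry_le_norm (R : realType) m n (A : 'M[R]_(m, n)) i j : `|A i j| <= `|A|.
Proof.
rewrite [leRHS]/Num.Def.normr/= mx_normrE; apply/bigmax_geP; right => /=.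
by exists (i, j).
Qed.

Lemma mx_norm_le_entries (R : realType) m n (A : 'M[R]_(m, n)) (a : R) :
  0 <= a -> (forall i j, `|A i j| <= a) -> `|A| <= a.
Proof.
move=> a0 Aa; rewrite [leLHS]/Num.Def.normr/= mx_normrE; exact: bigmax_le.
Qed.

Lemma strictly_convex_le (R : realType) (b : R -> R) : strictly_convex b ->
  forall x y t, 0 <= t <= 1 -> b (t * x + (1 - t) * y) <= t * b x + (1 - t) * b y.
Proof.
move=> cb x y t /andP[t0 t1].
have [->|xy] := eqVneq x y; first by rewrite -!mulrDl addrCA subrr addr0 !mul1r.
have [->|tn0] := eqVneq t 0; first by rewrite !mul0r subr0 !add0r !mul1r.
have [->|tn1] := eqVneq t 1; first by rewrite subrr !mul0r !addr0 !mul1r.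
by apply/ltW/cb => //; rewrite !lt_neqAle t0 t1 eq_sym tn0 tn1.
Qed.

Section maximum_likelihood.
Context (R : realType) (b k : R -> R)
  (mu : {measure set (measurableTypeR R) -> \bar R}) (Dom : set R).
Hypothesis family : glm_family b k mu Dom.
Context (C : R).
Hypothesis C1 : 1 <= C.
Hypothesis devC : forall x y : R, `|y| <= 2^-1 ->
  derive1n 2 b (x + y) <= C * derive1n 2 b x.
Context (n m : nat) (Z : 'M[R]_(n, m)) (t0 : 'cV[R]_m) (y c : 'I_n -> R).

Local Notation b1 := (derive1n 1 b).
Local Notation V := (derive1n 2 b).

Definition log_likelihood (t : 'cV[R]_m) : R :=
  \sum_i (y i * (Z *m t) i 0 - b ((Z *m t) i 0) + c i).
Definition residual (i : 'I_n) : R := y i - b1 ((Z *m t0) i 0).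
Definition fisher_form (v : 'cV[R]_m) : R :=
  \sum_i V ((Z *m t0) i 0) * (Z *m v) i 0 ^+ 2.

Local Notation L := log_likelihood.
Local Notation q := fisher_form.

Let C0 : 0 < C. Proof. exact: lt_le_trans C1. Qed.
Let V0 x : 0 <= V x. Proof. exact: (b2_ge0 family). Qed.

Lemma fisher_form_ge0 v : 0 <= q v.
Proof. by apply: sumr_ge0 => i _; apply: mulr_ge0; [exact: V0|exact: sqr_ge0]. Qed.

Lemma fisher_formZ s v : q (s *: v) = s ^+ 2 * q v.
Proof.
rewrite /q mulr_sumr; apply: eq_bigr => i _.
have -> : (Z *m (s *: v)) i 0 = s * (Z *m v) i 0 by rewrite -scalemxAr mxE.
by rewrite exprMn mulrCA.
Qed.

Lemma log_likelihood_concave s u v : 0 <= s <= 1 ->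
  s * L u + (1 - s) * L v <= L (s *: u + (1 - s) *: v).
Proof.
move=> s01; rewrite /L !mulr_sumr -big_split/=; apply: ler_sum => i _.
rewrite mulmxDr -!scalemxAr !mxE.
have cb : strictly_convex b by case: family => -[].
have := strictly_convex_le cb (\sum_j Z i j * u j 0) (\sum_j Z i j * v j 0) s01.
by lra.
Qed.

Context (tau : R).
Hypothesis tau0 : 0 < tau.
Hypothesis residual_le : forall v,
  \sum_i residual i * (Z *m v) i 0 <= tau * Num.sqrt (q v).
Local Notation rho := (3 * C * tau).
Hypothesis predictor_le : forall v i,
  `|(Z *m v) i 0| * rho <= 2^-1 * Num.sqrt (q v).
Context (beta : R).
Hypothesis beta0 : 0 <= beta.
Hypothesis norm_le : forall v, `|v| <= beta * Num.sqrt (q v).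

Let rho0 : 0 < rho. Proof. by rewrite !mulr_gt0. Qed.

Lemma predictor_small v i : Num.sqrt (q v) <= rho -> `|(Z *m v) i 0| <= 2^-1.
Proof.
move=> qr; rewrite -(ler_pM2r rho0); apply: le_trans (predictor_le v i) _.
by rewrite ler_wpM2l.
Qed.

(** At distance [rho] the linear term is at most [tau rho] and the curvature costs
    at least [rho^2 / (2 C)], which wins since [rho = 3 C tau > 2 C tau]. *)
Lemma likelihood_lt_boundary v : Num.sqrt (q v) = rho -> L (t0 + v) < L t0.
Proof.
move=> qv; have qle : Num.sqrt (q v) <= rho by rewrite qv.
have qE : q v = rho ^+ 2 by rewrite -qv sqr_sqrtr// fisher_form_ge0.
have H : L (t0 + v) - L t0 <=
    \sum_i residual i * (Z *m v) i 0 - (2 * C)^-1 * q v.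
  rewrite /L /q -sumrB mulr_sumr -sumrB; apply: ler_sum => i _.
  have := bregman_ge family C1 devC ((Z *m t0) i 0) (predictor_small i qle).
  have -> : (Z *m (t0 + v)) i 0 = (Z *m t0) i 0 + (Z *m v) i 0.
    by rewrite mulmxDr mxE.
  rewrite /residual.
  set e := (Z *m t0) i 0; set d := (Z *m v) i 0 => B.
  rewrite (_ : (2 * C)^-1 * (V e * d ^+ 2) = V e / (2 * C) * d ^+ 2); last by ring.
  by lra.
have := residual_le v; rewrite qv => T.
rewrite -subr_lt0; apply: le_lt_trans H _.
have -> : (2 * C)^-1 * q v = (9 / 2) * C * tau ^+ 2.
  by rewrite qE; field; rewrite gt_eqF.
have : 0 < C * tau ^+ 2 by rewrite mulr_gt0// exprn_gt0.
rewrite (_ : tau * rho = 3 * (C * tau ^+ 2)) in T; last by ring.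
by lra.
Qed.

Lemma likelihood_lt_outside v : rho <= Num.sqrt (q v) -> L (t0 + v) < L t0.
Proof.
move=> rq; set Q := Num.sqrt (q v) in rq.
have Q0 : 0 < Q by apply: lt_le_trans rq.
pose s := rho / Q.
have s0 : 0 < s by rewrite divr_gt0.
have s1 : s <= 1 by rewrite ler_pdivrMr// mul1r.
have B : L (t0 + s *: v) < L t0.
  apply: likelihood_lt_boundary.
  by rewrite fisher_formZ sqrtrM ?sqr_ge0// sqrtr_sqr gtr0_norm// -/Q divfK// gt_eqF.
have s01 : 0 <= s <= 1 by rewrite ltW.
have := log_likelihood_concave (t0 + v) t0 s01.
rewrite (_ : s *: (t0 + v) + (1 - s) *: t0 = t0 + s *: v); last first.
  by rewrite scalerDr scalerBl scale1r addrAC addrCA subrr addr0.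
move=> K; have : s * L (t0 + v) < s * L t0 by lra.
by rewrite ltr_pM2l.
Qed.

Lemma mle_close t : is_argmax L t -> Num.sqrt (q (t - t0)) < rho.
Proof.
move=> tmax; rewrite ltNge; apply/negP => /likelihood_lt_outside.
by rewrite addrCA subrr addr0 ltNge tmax.
Qed.

Lemma continuous_log_likelihood : continuous (fun v : 'rV[R]_m => L (t0 + v^T)).
Proof.
pose z i (v : 'rV[R]_m) := (Z *m (t0 + v^T)) i 0.
have cz i : continuous (z i).
  rewrite (_ : z i =
      fun v : 'rV[R]_m => \sum_j Z i j * (t0 j 0 + v 0 j)); last first.
    by apply/funext => v; rewrite /z mxE; apply: eq_bigr => j _; rewrite !mxE.
  apply: continuous_sum_fun => j v.
  have cj : (fun u : 'rV[R]_m => t0 j 0 + u 0 j) @ v --> t0 j 0 + v 0 j.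
    apply: (@cvgD R R 'rV[R]_m (nbhs v) _ (fun=> t0 j 0)
      (fun u : 'rV[R]_m => u 0 j)); first exact: cvg_cst.
    exact: coord_continuous.
  exact: cvgMl_tmp cj.
apply: continuous_sum_fun => i v.
apply: (@cvgD R R 'rV[R]_m (nbhs v) _ (fun v => y i * z i v - b (z i v))
  (fun=> c i)); last exact: cvg_cst.
apply: (@cvgB R R 'rV[R]_m (nbhs v) _ (fun v => y i * z i v)
  (fun v => b (z i v))); first exact: cvgMl_tmp (cz i v).
apply: (@continuous_comp _ _ _ (z i) b); first exact: cz.
exact: (@continuous_cumulant _ _ _ _ _ family 0).
Qed.

(** The likelihood is maximised over a box that contains the ellipsoid. *)
Lemma mle_exists : exists t, is_argmax L t.
Proof.
pose r := beta * rho.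
have r0 : 0 <= r by rewrite mulr_ge0// ltW.
pose A : set 'rV[R]_m := [set v | forall i, `[- r, r]%classic (v ord0 i)].
have A0 : A 0 by move=> i; rewrite /= in_itv/= mxE oppr_le0 r0.
have cA : compact A.
  by apply: (@rV_compact _ _ (fun=> `[- r, r]%classic)) => _; exact: segment_compact.
have [v vA vmax] := EVT_max_rV (ex_intro _ 0 A0) cA
  (continuous_subspaceT continuous_log_likelihood).
exists (t0 + v^T) => u.
have [uA|uA] := pselect (A (u - t0)^T).
  have := vmax (u - t0)^T; rewrite inE => /(_ uA).
  by rewrite trmxK addrCA subrr addr0.
have u_lt : L (t0 + (u - t0)) < L t0.
  apply: likelihood_lt_outside; rewrite leNgt; apply/negP => qu.
  apply: uA => i; rewrite /= in_itv/= -ler_norml mxE.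
  apply: le_trans (mx_entry_le_norm (u - t0) i ord0) _.
  by apply: le_trans (norm_le _) _; rewrite ler_wpM2l// ltW.
move: u_lt; rewrite addrCA subrr addr0 => /ltW/le_trans; apply.
by have := vmax 0; rewrite inE => /(_ A0); rewrite trmx0 addr0.
Qed.

Lemma score_equation t : is_argmax L t ->
  forall j, \sum_i Z i j * (y i - b1 ((Z *m t) i 0)) = 0.
Proof.
move=> tmax j; pose f (s : R) := L (t + s *: delta_mx j 0).
pose h (i : 'I_n) (s : R) := y i * ((Z *m t) i 0 + Z i j * s) -
     b ((Z *m t) i 0 + Z i j * s) + c i.
have fE : f = \sum_(i < n) h i.
  apply/funext => s; rewrite fct_sumE; apply: eq_bigr => i _.
  have -> // : (Z *m (t + s *: delta_mx j 0)) i 0 = (Z *m t) i 0 + Z i j * s.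
  by rewrite mulmxDr -scalemxAr -colE !mxE mulrC.
have df (s : R) : is_derive s 1 f
   (\sum_(i < n) (y i * Z i j - b1 ((Z *m t) i 0 + Z i j * s) * Z i j)).
  rewrite fE; apply: (@is_derive_sum R R R n h s 1
    (fun i => y i * Z i j - b1 ((Z *m t) i 0 + Z i j * s) * Z i j)) => i.
  have dl (x z : R) : is_derive s 1 (fun s => x + z * s) z.
    apply: (is_derive_eq (is_deriveD (is_derive_cst x s 1)
      (is_deriveZ z (is_derive_id s 1)))).
    by rewrite add0r; exact: mulr1.
  have db x z : is_derive s 1 (fun s => b (x + z * s)) (b1 (x + z * s) * z).
    apply: (@is_derive1_comp R b (fun s => x + z * s)) => //.
    exact: (@is_derive_cumulant _ _ _ _ _ family 0).
  apply: (is_derive_eq (is_deriveD (is_deriveB (is_deriveZ (y i)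
     (dl ((Z *m t) i 0) (Z i j))) (db ((Z *m t) i 0) (Z i j)))
     (is_derive_cst (c i) s 1))).
  by rewrite addr0.
have f0 : is_derive (0:R) 1 f 0.
  apply: (@derive1_at_max R f (-1) 1 0); first lra.
  - by move=> s _; case: (df s).
  - by rewrite in_itv/=; apply/andP; split; lra.
  by move=> s _; rewrite /f scale0r addr0.
have := @derive_val _ _ _ _ _ _ _ (df 0).
rewrite (@derive_val _ _ _ _ _ _ _ f0) => E.
by rewrite [RHS]E; apply: eq_bigr => i _; rewrite mulr0 addr0; ring.
Qed.

Lemma fisher_mul_entry (v : 'cV[R]_m) (j : 'I_m) :
  (fisher b Z t0 *m v) j 0 = \sum_i Z i j * (V ((Z *m t0) i 0) * (Z *m v) i 0).
Proof.
rewrite /fisher mulmx_suml summxE; apply: eq_bigr => i _.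
rewrite -scalemxAl -mulmxA [LHS]mxE mulrCA; congr (_ * _).
by rewrite mxE big_ord1 !mxE; congr (_ * _); apply: eq_bigr => l _; rewrite mxE.
Qed.

Lemma row_sum_norm_mul p1 p2 (A : 'M[R]_(p1, p2)) (u : 'cV[R]_p2) (a : R) :
  0 <= a -> (forall j, `|u j 0| <= a) -> `|A *m u| <= row_sum_norm A * a.
Proof.
move=> a0 ua; have r0 : 0 <= row_sum_norm A by exact: bigmax_ge_id.
apply: mx_norm_le_entries => [|i j]; first exact: mulr_ge0.
rewrite ord1 mxE; apply: le_trans (ler_norm_sum _ _ _) _.
apply: (@le_trans _ _ ((\sum_l `|A i l|) * a)).
  by rewrite mulr_suml; apply: ler_sum => l _; rewrite normrM ler_wpM2l.
by rewrite ler_wpM2r//; exact: le_bigmax.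
Qed.

(** The score equation gives [F (t - t0) = Z^T eps - r], where [r] is the
    remainder of [score_remainder_le]; [r] is quadratic in the predictors and hence
    controlled by [mle_close]. *)
Lemma mle_error t (zmax sigma g : R) : is_argmax L t ->
  0 <= zmax -> (forall i j, `|Z i j| <= zmax) -> 0 <= sigma ->
  (forall i, Num.sqrt (V ((Z *m t0) i 0)) <= sigma) ->
  0 <= g -> (forall j, `|\sum_i Z i j * residual i| <= g) ->
  fisher b Z t0 \in unitmx ->
  `|t - t0| <= row_sum_norm (invmx (fisher b Z t0)) *
     (g + zmax * (remainder_const C * (2 + sigma) * rho ^+ 2)).
Proof.
move=> tmax zmax0 Zle sigma0 sigma_le g0 score_le Funit.
set v := t - t0; set F := fisher b Z t0 in Funit *.
have -> : `|v| = `|invmx F *m (F *m v)| by rewrite mulKmx.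
have qv : Num.sqrt (q v) < rho := mle_close tmax.
have K0 := remainder_const_ge0 (ltW C0).
have qle : q v <= rho ^+ 2.
  by rewrite -[q v]sqr_sqrtr ?fisher_form_ge0// lerXn2r ?nnegrE ?sqrtr_ge0 ?ltW.
have K1 : 0 <= remainder_const C * (2 + sigma) by rewrite mulr_ge0// addr_ge0.
apply: row_sum_norm_mul => [|j].
  by rewrite addr_ge0// mulr_ge0// mulr_ge0// sqr_ge0.
pose r i := b1 ((Z *m t0) i 0 + (Z *m v) i 0) - b1 ((Z *m t0) i 0)
  - V ((Z *m t0) i 0) * (Z *m v) i 0.
have -> : (F *m v) j 0 = \sum_i Z i j * residual i - \sum_i Z i j * r i.
  rewrite fisher_mul_entry -sumrB.
  transitivity (\sum_i Z i j * (V ((Z *m t0) i 0) * (Z *m v) i 0) +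
    \sum_i Z i j * (y i - b1 ((Z *m t) i 0))).
    by rewrite score_equation// addr0.
  rewrite -big_split; apply: eq_bigr => i _ /=; rewrite /r /residual.
  have -> : (Z *m t) i 0 = (Z *m t0) i 0 + (Z *m v) i 0.
    by rewrite -{1}(subrK t0 t) mulmxDr mxE addrC.
  by ring.
apply: le_trans (ler_normB _ _) _; apply: lerD; first exact: score_le.
apply: le_trans (ler_norm_sum _ _ _) _.
apply: (@le_trans _ _ (\sum_i zmax * (remainder_const C * (2 + sigma) *
    (V ((Z *m t0) i 0) * (Z *m v) i 0 ^+ 2)))).
  apply: ler_sum => i _; rewrite normrM; apply: ler_pM => //.
  have := score_remainder_le family C1 devC ((Z *m t0) i 0)
    (predictor_small i (ltW qv)).
  move/le_trans; apply.
  have w0 := V0 ((Z *m t0) i 0); have := sigma_le i.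
  move: w0; set w := V _; set e2 := _ ^+ 2 => w0 ws.
  have e20 : 0 <= e2 by exact: sqr_ge0.
  rewrite [leLHS](_ : _ = remainder_const C * (w * e2) * (2 + Num.sqrt w));
    last by ring.
  rewrite [leRHS](_ : _ = remainder_const C * (w * e2) * (2 + sigma)); last by ring.
  by rewrite ler_wpM2l ?lerD2l// mulr_ge0// mulr_ge0.
rewrite -!mulr_sumr -/(q v) ler_wpM2l// ler_wpM2l//.
Qed.

End maximum_likelihood.

(** * Calculus of events of high probability *)

Section high_probability.
Context (R : realType) d (T : measurableType d) (P : probability T R).
Local Open Scope ereal_scope.

Lemma with_prob_ge_sub (q q' : R) (E E' : set T) : (q' <= q)%R -> E `<=` E' ->
  with_prob_ge P q E -> with_prob_ge P q' E'.
Proof.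
move=> qq EE [A [mA AE PA]]; exists A; split=> //; first exact: subset_trans AE EE.
by apply: le_trans PA; rewrite lee_fin.
Qed.

Lemma with_prob_geI (r r' : R) (E E' : set T) :
  with_prob_ge P (1 - r) E -> with_prob_ge P (1 - r') E' ->
  with_prob_ge P (1 - (r + r')) (E `&` E').
Proof.
move=> [A [mA AE PA]] [A' [mA' AE' PA']]; exists (A `&` A'); split.
- exact: measurableI.
- exact: setISS.
have PC (B : set T) s : measurable B -> (1 - s)%:E <= P B -> P (~` B) <= s%:E.
  move=> mB; rewrite probability_setC// -(fineK (fin_num_measure P B mB)).
  by rewrite -EFinB !lee_fin; lra.
have : P (~` A `|` ~` A') <= (r + r')%:E.
  apply: le_trans (measureU2 P _ _) _; [exact: measurableC|exact: measurableC|].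
  by rewrite EFinD leeD//; exact: PC.
rewrite -setCI probability_setC; last exact: measurableI.
rewrite -(fineK (fin_num_measure P _ (measurableI _ _ mA mA'))).
by rewrite -EFinB !lee_fin; lra.
Qed.

Lemma with_prob_ge_seq (I : eqType) (s : seq I) (r : I -> R) (E : I -> set T) :
  (forall i, i \in s -> with_prob_ge P (1 - r i) (E i)) ->
  with_prob_ge P (1 - \sum_(i <- s) r i) [set w | forall i, i \in s -> E i w].
Proof.
elim: s => [_|i s IH Es].
  rewrite big_nil subr0; exists [set: T]; split=> //.
  by rewrite probability_setT.
rewrite big_cons; have Ei := Es i (mem_head _ _).
have {}IH : with_prob_ge P (1 - \sum_(i <- s) r i)
    [set w | forall i, i \in s -> E i w].
  by apply: IH => j js; apply: Es; rewrite inE js orbT.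
apply: with_prob_ge_sub (with_prob_geI Ei IH) => // w [wi ws] j.
by rewrite inE => /predU1P[->//|]; exact: ws.
Qed.

Lemma with_prob_ge_all (I : finType) (Q : pred I) (r : R) (N : nat)
    (E : I -> set T) : (0 <= r)%R -> (#|Q| <= N)%N ->
  (forall i, Q i -> with_prob_ge P (1 - r) (E i)) ->
  with_prob_ge P (1 - N%:R * r) [set w | forall i, Q i -> E i w].
Proof.
move=> r0 QN HE.
apply: with_prob_ge_sub (@with_prob_ge_seq _ (enum Q) (fun=> r) E _) => [|w H i Qi|i].
- rewrite big_const_seq count_predT -cardE iter_addr_0 -[(r *+ _)%R]mulr_natl.
  by rewrite lerD2l lerN2 ler_wpM2r// ler_nat.
- by apply: H; rewrite mem_enum.
by rewrite mem_enum => /HE.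
Qed.

Lemma with_prob_ge_lt (f : T -> R) (a r : R) : measurable_fun [set: T] f ->
  P [set w | (a <= f w)%R] <= r%:E ->
  with_prob_ge P (1 - r) [set w | (f w < a)%R].
Proof.
move=> mf Pr; exists [set w | (f w < a)%R]; split=> //.
  rewrite (_ : [set w | _] = [set: T] `&` f @^-1` `]-oo, a[%classic).
    exact: mf.
  by rewrite setTI; apply/seteqP; split=> w; rewrite /= in_itv.
have -> : [set w | (f w < a)%R] = ~` [set w | (a <= f w)%R].
  by apply/seteqP; split=> w /=; rewrite ltNge => /negP.
have mA : measurable [set w | (a <= f w)%R].
  rewrite (_ : [set w | _] = [set: T] `&` f @^-1` `[a, +oo[%classic).
    exact: mf.
  by rewrite setTI; apply/seteqP; split=> w; rewrite /= in_itv/= andbT.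
rewrite probability_setC//; move: Pr.
by rewrite -(fineK (fin_num_measure P _ mA)) -EFinB !lee_fin; lra.
Qed.

End high_probability.

(** * Sparse submodels *)

Section submodels.
Context (R : realType) (p : nat) (S : {set 'I_p}).

Lemma extend_enum_val (v : 'cV[R]_#|S|) l : extend v (enum_val l) 0 = v l 0.
Proof.
rewrite mxE (eq_bigl (fun l' => l' == l)) ?big_pred1_eq// => l'.
exact: (inj_eq enum_val_inj).
Qed.

Lemma extend_notin (v : 'cV[R]_#|S|) j : j \notin S -> extend v j 0 = 0.
Proof.
move=> jS; rewrite mxE big1// => l /eqP lj.
by move: jS; rewrite -lj enum_valP.
Qed.

Lemma sum_extend (v : 'cV[R]_#|S|) (f : 'I_p -> R -> R) :
  (forall j, f j 0 = 0) ->
  \sum_j f j (extend v j 0) = \sum_l f (enum_val l) (v l 0).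
Proof.
move=> f0; rewrite (bigID (mem S))/= [X in _ + X]big1 ?addr0 => [|j jS]; last first.
  by rewrite extend_notin.
rewrite big_enum_val/=; apply: eq_bigr => l _; by rewrite extend_enum_val.
Qed.

Lemma mul_extend n (X : 'M[R]_(n, p)) (v : 'cV[R]_#|S|) :
  X *m extend v = cols X S *m v.
Proof.
apply/matrixP => i j; rewrite ord1 !mxE.
rewrite (@sum_extend v (fun j x => X i j * x)) => [|j']; last by rewrite mulr0.
by apply: eq_bigr => l _; rewrite [in RHS]mxE.
Qed.

Lemma norm2_extend (v : 'cV[R]_#|S|) : norm2 (extend v) = norm2 v.
Proof.
congr Num.sqrt; rewrite (@sum_extend v (fun j x => x ^+ 2))// => _.
by rewrite expr0n.
Qed.

Lemma supp_extend (v : 'cV[R]_#|S|) : supp (extend v) \subset S.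
Proof.
apply/fintype.subsetP => j; rewrite inE; apply: contraR => /extend_notin ->.
by rewrite eqxx.
Qed.

Lemma restrictK (t : 'cV[R]_p) : supp t \subset S ->
  extend (\col_(l < #|S|) t (enum_val l) 0) = t.
Proof.
move=> /fintype.subsetP tS; apply/matrixP => j i; rewrite ord1.
have [jS|jS] := boolP (j \in S).
  by rewrite -(enum_rankK_in jS jS) extend_enum_val mxE.
rewrite extend_notin//; apply/esym/eqP; apply: contraR jS => tj.
by apply: tS; rewrite inE.
Qed.

End submodels.

Section restricted_eigenvalue.
Context (R : realType) (n p : nat) (X : 'M[R]_(n, p)) (d : 'I_n -> R).
Hypothesis d0 : forall i, 0 <= d i.
Context (s : R).
Hypothesis n0 : (0 < n)%N.
Local Notation W := (diag_mx (\row_i d i)).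
Local Notation phi := (phi2 X W s).

Let quad (t : 'cV[R]_p) := \sum_i d i * (X *m t) i 0 ^+ 2.

Let quadE t : (t^T *m X^T *m W *m X *m t) 0 0 = quad t.
Proof.
rewrite -trmx_mul -[_ *m X *m t]mulmxA mxE; apply: eq_bigr => i _.
by rewrite mul_mx_diag !mxE; ring.
Qed.

Let quad_ge0 t : 0 <= quad t.
Proof. by apply: sumr_ge0 => i _; rewrite mulr_ge0// sqr_ge0. Qed.

Lemma phi2_le (t : 'cV[R]_p) : 0 < phi -> #|supp t|%:R <= s ->
  n%:R * phi ^+ 2 * norm2 t ^+ 2 <= quad t.
Proof.
move=> phi0 ts.
have [t0|t0] := eqVneq (norm2 t) 0.
  by rewrite t0 expr0n mulr0.
have supp0 : (0 < #|supp t|)%N.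
  rewrite card_gt0; apply: contra t0 => /eqP st.
  rewrite /norm2 big1 ?sqrtr0// => j _.
  by apply/eqP; rewrite sqrf_eq0; have := finset.in_set0 j; rewrite -st inE => /negbFE.
move: phi0; rewrite /phi2; set A := (X in inf X) => phi0.
have A0 : 0 <= inf A by move: phi0; rewrite sqrtr_gt0 => /ltW.
rewrite sqr_sqrtr//.
have : inf A <= n%:R^-1 * quad t / norm2 t ^+ 2.
  apply: ge_inf.
    exists 0 => _ [u _ <-]; rewrite quadE.
    by rewrite divr_ge0 ?sqr_ge0// mulr_ge0// invr_ge0.
  by exists t; [rewrite /= supp0 ts|rewrite quadE].
have nt : 0 < norm2 t ^+ 2 by rewrite exprn_gt0// lt_neqAle eq_sym t0 norm2_ge0.
by rewrite ler_pdivlMr// ler_pdivlMl ?ltr0n// mulrA.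
Qed.

End restricted_eigenvalue.

(** * Uniform bounds on the noise *)

(** A nonempty set with at most [N] elements is the image of a map from ['I_N]:
    its enumeration, padded with one of its elements. *)
Lemma card_small_sets (T : finType) (N : nat) :
  (#|[pred S : {set T} | (S != finset.set0) && (#|S| <= N)%N]| <= #|T| ^ N)%N.
Proof.
rewrite -[X in (_ <= _ ^ X)%N](card_ord N) -card_ffun.
pose f (g : {ffun 'I_N -> T}) : {set T} := [set g i | i in 'I_N]%SET.
apply: leq_trans (leq_imset_card f predT).
apply/subset_leq_card/fintype.subsetP => S; rewrite inE => /andP[S0 SN].
have [x0 x0S] := set0Pn _ S0.
apply/imsetP; exists [ffun i : 'I_N => nth x0 (enum S) i] => //.
apply/setP => x; apply/idP/imsetP => [xS|[i _ ->]].
  have xi : (index x (enum S) < N)%N.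
    by apply: leq_trans SN; rewrite cardE index_mem mem_enum.
  by exists (Ordinal xi) => //; rewrite ffunE nth_index// mem_enum.
rewrite ffunE; have [iS|iS] := ltnP i (size (enum S)).
  by rewrite -mem_enum mem_nth.
by rewrite nth_default.
Qed.

Section uniform_noise_bounds.
Context (R : realType) (b k : R -> R)
  (mu : {measure set (measurableTypeR R) -> \bar R}) (Dom : set R).
Hypothesis family : glm_family b k mu Dom.
Context (C : R).
Hypothesis C1 : 1 <= C.
Hypothesis devC : forall x y : R, `|y| <= 2^-1 ->
  derive1n 2 b (x + y) <= C * derive1n 2 b x.
Context d (T : measurableType d) (P : probability T R)
  (n : nat) (Y : 'I_n -> {RV P >-> R}) (eta : 'I_n -> R).
Hypothesis indY : mutually_independent Y.
Hypothesis HY : forall i, glm_response b k mu Dom (eta i) (Y i).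

Local Notation V := (derive1n 2 b).
Local Notation eps := (noise b Y eta).

Lemma with_prob_noise_lt (a : 'I_n -> R) (tau r : R) : (forall i, `|a i| <= 2^-1) ->
  expR (C * (\sum_i V (eta i) * a i ^+ 2) - tau) <= r ->
  with_prob_ge P (1 - r) [set w | \sum_i a i * eps i w < tau].
Proof.
move=> a2 ar; apply: with_prob_ge_lt; first exact: measurable_noise_sum.
apply: le_trans (noise_sum_tail family C1 devC indY HY tau a2) _.
by rewrite lee_fin.
Qed.

Lemma noise_coordinates p (X : 'M[R]_(n, p)) (t v L : R) : 0 < t ->
  t * `|X| <= 2^-1 -> 0 <= L ->
  (forall j, C * (\sum_i V (eta i) * X i j ^+ 2) <= v) ->
  with_prob_ge P (1 - (2 * p)%:R * expR (t ^+ 2 * v - t * L))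
    [set w | forall j, `|\sum_i X i j * eps i w| <= L].
Proof.
move=> t0 tX L0 Xv.
pose E (q : 'I_p * bool) : set T :=
  [set w | \sum_i (t * ((-1) ^+ q.2 * X i q.1)) * eps i w < t * L].
have cardI : (#|xpredT : pred ('I_p * bool)| <= 2 * p)%N.
  by apply: leq_trans (max_card _) _; rewrite card_prod card_ord card_bool mulnC.
apply: with_prob_ge_sub (@with_prob_ge_all _ _ _ P _ xpredT
  (expR (t ^+ 2 * v - t * L)) _ E (expR_ge0 _) cardI _) => // [w H j|q _].
- have signed (e : bool) : \sum_i t * ((-1) ^+ e * X i j) * eps i w =
      (-1) ^+ e * (t * \sum_i X i j * eps i w).
    by rewrite !mulr_sumr; apply: eq_bigr => i _; ring.
  have side (e : bool) : (-1) ^+ e * (t * \sum_i X i j * eps i w) < t * L.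
    by rewrite -signed; exact: H (j, e) isT.
  have := side true; have := side false; rewrite expr0 expr1 mul1r => Hp Hm.
  rewrite ler_norml; apply/andP; split; rewrite -(ler_pM2l t0); last exact: ltW.
  by lra.
- apply: with_prob_noise_lt => [i|].
    rewrite !normrM normrX normrN1 expr1n mul1r (gtr0_norm t0).
    by apply: le_trans tX; rewrite ler_pM2l//; exact: mx_entry_le_norm.
  rewrite ler_expR lerD2r.
  rewrite [leLHS](_ : _ = t ^+ 2 * (C * \sum_i V (eta i) * X i q.1 ^+ 2)).
    by rewrite ler_wpM2l// sqr_ge0.
  rewrite !mulr_sumr; apply: eq_bigr => i _.
  by rewrite !exprMn sqrr_sign; ring.
Qed.

(** In the coordinates of an orthonormal frame for [q], the supremum of
    [eps^T Z v / sqrt (q v)] is the norm of a vector [h] depending on the noise, and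
    [grid_direction] bounds it by a maximum over finitely many fixed directions,
    each of which is covered by the Chernoff bound. *)
Lemma noise_directions m (Z : 'M[R]_(n, m)) (t K : R) : 0 < t -> (0 < m)%N ->
  let q (v : 'cV[R]_m) := \sum_i V (eta i) * (Z *m v) i 0 ^+ 2 in
  (forall v, v != 0 -> 0 < q v) ->
  (forall v i, t * `|(Z *m v) i 0| <= 2^-1 * Num.sqrt (q v)) ->
  with_prob_ge P (1 - ((2 * (2 * m).+1) ^ m)%:R * expR ((C - K) * t ^+ 2))
    [set w | forall v,
      \sum_i eps i w * (Z *m v) i 0 <= 2 * K * t * Num.sqrt (q v)].
Proof.
move=> t0 m0 q qpos Zsmall.
have [A [qE symA]] : exists A : 'M[R]_m,
    (forall v, (v^T *m A *m v) 0 0 = q v) /\ A^T = A.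
  exists (Z^T *m diag_mx (\row_i V (eta i)) *m Z); split=> [v|].
    rewrite !mulmxA -trmx_mul -[_ *m Z *m v]mulmxA mxE; apply: eq_bigr => i _.
    by rewrite mul_mx_diag !mxE; ring.
  by rewrite !trmx_mul trmxK tr_diag_mx mulmxA.
have [B BAB] : exists B : 'M[R]_m, B^T *m A *m B = 1%:M.
  by apply: orthonormal_frame => // v v0; rewrite qE; exact: qpos.
have qB z : q (B *m z) = norm2 z ^+ 2.
  rewrite -qE trmx_mul (_ : _ *m _ = z^T *m (B^T *m A *m B) *m z).
    by rewrite BAB mulmx1 trmx_mul_norm2.
  by rewrite !mulmxA.
pose N := (2 * m)%N.
have N0 : 0 < N%:R :> R by rewrite ltr0n muln_gt0.
pose dir (c : {ffun 'I_m -> 'I_N.+1 * bool}) := N%:R^-1 *: (B *m grid_vector R c).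
pose E c : set T := [set w | \sum_i (t * (Z *m dir c) i 0) * eps i w < K * t ^+ 2].
pose Q (c : {ffun 'I_m -> 'I_N.+1 * bool}) := norm2 (grid_vector R c) <= N%:R.
have cardQ : (#|Q| <= (2 * N.+1) ^ m)%N.
  apply: leq_trans (max_card _) _.
  by rewrite card_ffun card_prod !card_ord card_bool mulnC.
have qdir c : Q c -> q (dir c) <= 1.
  move=> Qc; rewrite (_ : q _ = N%:R^-1 ^+ 2 * q (B *m grid_vector R c)).
    rewrite qB -exprMn exprn_ile1//.
      by rewrite mulr_ge0 ?norm2_ge0 ?invr_ge0 ?ltW.
    by rewrite mulrC ler_pdivrMr// mul1r.
  rewrite /q mulr_sumr; apply: eq_bigr => i _; rewrite [RHS]mulrCA -exprMn; congr (_ * _ ^+ 2).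
  by rewrite -scalemxAr mxE.
apply: with_prob_ge_sub (@with_prob_ge_all _ _ _ P _ Q
  (expR ((C - K) * t ^+ 2)) _ E (expR_ge0 _) cardQ _) => // [w H v|c Qc].
- pose e : 'cV[R]_n := \col_i eps i w.
  pose h := B^T *m Z^T *m e.
  have dotE z : \sum_i eps i w * (Z *m (B *m z)) i 0 = (z^T *m h) 0 0.
    rewrite /h !mulmxA -!trmx_mul mxE; apply: eq_bigr => i _.
    by rewrite mulmxA !mxE mulrC.
  have [c [zN zh]] := grid_direction h.
  set z := grid_vector R c in zN zh.
  have h_lt : norm2 h <= 2 * K * t.
    have := H c zN; rewrite /E/=.
    rewrite (_ : \sum_i _ = t * N%:R^-1 * (z^T *m h) 0 0); last first.
      rewrite -dotE mulr_sumr; apply: eq_bigr => i _.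
      by rewrite /dir -scalemxAr mxE -/z; ring.
    rewrite (_ : K * t ^+ 2 = t * N%:R^-1 * (N%:R * K * t)); last first.
      by field; rewrite gt_eqF.
    rewrite ltr_pM2l ?mulr_gt0 ?invr_gt0// => /(le_lt_trans zh)/ltW zK.
    have mR : 0 < m%:R :> R by rewrite ltr0n.
    by rewrite -(ler_pM2l mR); apply: le_trans zK _; rewrite /N natrM; lra.
  pose y := B^T *m A *m v.
  have vE : v = B *m y by exact: frame_inv.
  rewrite vE dotE qB sqrtr_sqr ger0_norm ?norm2_ge0//.
  apply: le_trans (cauchy_schwarz _ _) _.
  by rewrite mulrC ler_wpM2r// norm2_ge0.
- have qd := qdir c Qc; have q0 : 0 <= q (dir c).
    have [->|/qpos/ltW//] := eqVneq (dir c) 0.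
    by rewrite /q big1// => i _; rewrite mulmx0 mxE expr0n mulr0.
  apply: with_prob_noise_lt => [i|].
    rewrite normrM (gtr0_norm t0); apply: le_trans (Zsmall _ _) _.
    by rewrite ler_piMr// -sqrtr1 ler_sqrt.
  rewrite ler_expR mulrBl lerD2r.
  rewrite (_ : \sum_i _ = t ^+ 2 * q (dir c)); last first.
    by rewrite /q mulr_sumr; apply: eq_bigr => i _; rewrite exprMn mulrCA.
  rewrite ler_wpM2l ?(le_trans ler01 C1)//.
  by rewrite ler_piMr// sqr_ge0.
Qed.

End uniform_noise_bounds.

(** * The bound for one sample *)

Lemma fisher_tr (R : realType) (b : R -> R) n m (Z : 'M[R]_(n, m)) t0 :
  (fisher b Z t0)^T = fisher b Z t0.
Proof.
rewrite /fisher linear_sum/=; apply: eq_bigr => i _.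
by rewrite linearZ/= trmx_mul trmxK.
Qed.

Lemma fisher_quadratic (R : realType) (b : R -> R) n m (Z : 'M[R]_(n, m))
    (t0 v : 'cV[R]_m) : (v^T *m fisher b Z t0 *m v) 0 0 = fisher_form b Z t0 v.
Proof.
rewrite -mulmxA mxE.
under eq_bigr => j _ do rewrite fisher_mul_entry mulr_sumr.
rewrite exchange_big/=; apply: eq_bigr => i _.
rewrite expr2 mulrA [X in _ = _ * X]mxE mulr_sumr; apply: eq_bigr => j _.
by rewrite [v^T 0 j]mxE; ring.
Qed.

Lemma fisher_unit (R : realType) (b : R -> R) n m (Z : 'M[R]_(n, m)) (t0 : 'cV[R]_m) :
  (forall v, v != 0 -> 0 < fisher_form b Z t0 v) -> fisher b Z t0 \in unitmx.
Proof.
move=> qpos; have [B] : exists B : 'M[R]_m, B^T *m fisher b Z t0 *m B = 1%:M.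
  apply: orthonormal_frame => [|v v0]; first exact: fisher_tr.
  by rewrite fisher_quadratic; exact: qpos.
rewrite -mulmxA => /mulmx1_unit[_]; rewrite unitmx_mul => /andP[].
by [].
Qed.

Section one_sample.
Context (R : realType) (b k : R -> R)
  (mu : {measure set (measurableTypeR R) -> \bar R}) (Dom : set R).
Hypothesis family : glm_family b k mu Dom.
Context (C : R).
Hypothesis C1 : 1 <= C.
Hypothesis devC : forall x y : R, `|y| <= 2^-1 ->
  derive1n 2 b (x + y) <= C * derive1n 2 b x.
Context (n : nat) (M : glm R n).
Hypothesis model : glm_model b k M mu Dom.
Context (Kdim Ktheta Ccol : R).
Hypothesis Kdim1 : 1 < Kdim.
Hypothesis Ccol0 : 0 <= Ccol.

Local Notation p := (ncov M).
Local Notation X := (design M).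
Local Notation theta0 := (truth M).
Local Notation P := (prob M).
Local Notation V := (derive1n 2 b).
Local Notation lnp := (ln p%:R : R).
Local Notation s := ((s0 M)%:R : R).
Local Notation phi := (phi2_tilde b M Kdim).
Local Notation sigma := (Num.sqrt (sigma2_max b M)).
Local Notation eta := (fun i => (X *m theta0) i 0).
Local Notation eps := (noise b (resp M) eta).

(** In units of [s0 ln p], the exponent of the union bound is made of [Kdim + 1] for
    the models, [2 (Kdim + 1)] for the grids and [C] for the moment generating
    function; the last unit is the probability [1 / p] that remains. *)
Definition direction_const : R := C + 3 * (Kdim + 1) + 1.
(** The precision at which [H3] is used: the predictors move by at most
    1/2 on the ellipsoid of radius [6 C direction_const sqrt (s0 ln p)]. *)
Definition sparsity_const : R := (12 * C * direction_const * (Kdim + 1))^-1.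

Hypothesis truth0 : theta0 != 0.
Hypothesis n0 : (0 < n)%N.
Hypothesis p6 : (6 <= p)%N.
Hypothesis phi0 : 0 < phi.
Hypothesis design_small : Num.sqrt (lnp / n%:R) * `|X| <= 2^-1.
Hypothesis columns_le : forall j, norm2 (col j X) <= Ccol * Num.sqrt n%:R.
Hypothesis sparsity :
  `|X| * s * Num.sqrt lnp <= sparsity_const * phi * Num.sqrt n%:R.

Let V0 x : 0 <= V x. Proof. exact: (b2_ge0 family). Qed.
Let C0 : 0 < C. Proof. exact: lt_le_trans C1. Qed.
Let nR : 0 < n%:R :> R. Proof. by rewrite ltr0n. Qed.
Let pR : 6 <= p%:R :> R. Proof. by rewrite ler_nat. Qed.
Let lnp0 : 0 < lnp. Proof. by apply: ln_gt0; apply: lt_le_trans pR; rewrite ltr1n. Qed.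
Let K1 : 0 < Kdim + 1. Proof. by rewrite addr_gt0// (lt_trans ltr01). Qed.
Let Kt0 : 0 < direction_const.
Proof. by rewrite /direction_const !addr_gt0// mulr_gt0. Qed.

Lemma s0_gt0 : (0 < s0 M)%N.
Proof.
rewrite /s0 card_gt0; apply: contra truth0 => /eqP S0e.
apply/eqP/matrixP => j i; rewrite ord1 [RHS]mxE.
by have := finset.in_set0 j; rewrite -S0e inE => /negbFE/eqP.
Qed.

Let s1 : 1 <= s. Proof. by rewrite ler1n s0_gt0. Qed.

Lemma sigma2_max_ge i : V (eta i) <= sigma2_max b M.
Proof. exact: (@le_bigmax _ _ _ 0 (fun i => V (eta i))). Qed.

Lemma sigma2_max_ge0 : 0 <= sigma2_max b M.
Proof. exact: bigmax_ge_id. Qed.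

Lemma sum_weight_column j :
  \sum_i V (eta i) * X i j ^+ 2 <= sigma2_max b M * (Ccol ^+ 2 * n%:R).
Proof.
apply: (@le_trans _ _ (sigma2_max b M * norm2 (col j X) ^+ 2)).
  rewrite sqr_norm2 mulr_sumr; apply: ler_sum => i _; rewrite [col _ _ _ _]mxE.
  by rewrite ler_wpM2r ?sqr_ge0//; exact: sigma2_max_ge.
rewrite ler_wpM2l ?sigma2_max_ge0//.
rewrite -[n%:R in leRHS]sqr_sqrtr ?ler0n// -exprMn lerXn2r ?nnegrE ?norm2_ge0//.
by rewrite mulr_ge0.
Qed.

Section submodel.
Context (S : {set 'I_p}).
Hypothesis S0S : S0 M \subset S.
Hypothesis Ssmall : #|S|%:R <= (Kdim + 1) * s.

Local Notation Z := (cols X S).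
Definition true_restriction : 'cV[R]_#|S| := \col_(l < #|S|) theta0 (enum_val l) 0.
Local Notation q := (fisher_form b Z true_restriction).

Lemma mul_true_restriction : Z *m true_restriction = X *m theta0.
Proof. by rewrite -mul_extend restrictK. Qed.

Lemma submodel_form_ge v : n%:R * phi ^+ 2 * norm2 v ^+ 2 <= q v.
Proof.
rewrite -norm2_extend /fisher_form mul_true_restriction -mul_extend.
apply: (@phi2_le R n p X (fun i => V (eta i)) _ ((Kdim + 1) * s)) => //.
by apply: le_trans Ssmall; rewrite ler_nat subset_leq_card// supp_extend.
Qed.

Lemma norm2_le_form v : Num.sqrt n%:R * phi * norm2 v <= Num.sqrt (q v).
Proof.
have := submodel_form_ge v; rewrite -(ler_sqrt _ (fisher_form_ge0 family _ _ _)).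
rewrite (_ : n%:R * phi ^+ 2 * _ = (Num.sqrt n%:R * phi * norm2 v) ^+ 2); last first.
  by rewrite !exprMn (sqr_sqrtr (ler0n R n)).
by rewrite sqrtr_sqr ger0_norm// !mulr_ge0 ?norm2_ge0// ltW.
Qed.

Lemma submodel_form_gt0 v : v != 0 -> 0 < q v.
Proof.
rewrite -norm2_eq0 => v0; apply: lt_le_trans (submodel_form_ge v).
have nv : 0 < norm2 v by rewrite lt_neqAle eq_sym v0 norm2_ge0.
apply: mulr_gt0; last exact: exprn_gt0.
by apply: mulr_gt0 => //; exact: exprn_gt0.
Qed.

Lemma submodel_inj (v : 'cV[R]_#|S|) : Z *m v = 0 -> v = 0.
Proof.
move=> Zv; have [//|/submodel_form_gt0] := eqVneq v 0.
by rewrite /fisher_form Zv big1 ?ltxx// => i _; rewrite [X in X ^+ 2]mxE expr0n mulr0.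
Qed.

Lemma predictor_le_norm2 v i :
  `|(Z *m v) i 0| <= `|X| * (Num.sqrt #|S|%:R * norm2 v).
Proof.
pose a : 'cV[R]_#|S| := \col_l `|v l 0|.
have na : norm2 a = norm2 v.
  by congr Num.sqrt; apply: eq_bigr => l _; rewrite mxE real_normK ?num_real.
have n1 : norm2 (const_mx 1 : 'cV[R]_#|S|) = Num.sqrt #|S|%:R.
  congr Num.sqrt; under eq_bigr do rewrite mxE expr1n.
  by rewrite sumr_const card_ord.
have := cauchy_schwarz (const_mx 1) a; rewrite na n1 => H.
rewrite mxE; apply: le_trans (ler_norm_sum _ _ _) _.
apply: (@le_trans _ _ (`|X| * \sum_l `|v l 0|)).
  rewrite mulr_sumr; apply: ler_sum => l _; rewrite normrM ler_wpM2r//.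
  by rewrite mxE; exact: mx_entry_le_norm.
rewrite ler_wpM2l//; apply: le_trans H.
by rewrite mxE; apply: ler_sum => l _; rewrite !mxE mul1r.
Qed.

Lemma predictor_le_form v i :
  Num.sqrt (s * lnp) * `|(Z *m v) i 0| <= (12 * C * direction_const)^-1 * Num.sqrt (q v).
Proof.
have s00 : 0 <= s by [].
have sS : Num.sqrt #|S|%:R <= (Kdim + 1) * Num.sqrt s.
  apply: (@le_trans _ _ (Num.sqrt ((Kdim + 1) * s))).
    by rewrite ler_sqrt// mulr_ge0// ltW.
  rewrite (sqrtrM _ (ltW K1)) ler_wpM2r//.
  rewrite -[leRHS]gtr0_norm// -sqrtr_sqr ler_sqrt ?sqr_ge0//.
  by rewrite expr2 ler_peMr ?(ltW K1)// lerDr ltW// (lt_trans ltr01).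
apply: (@le_trans _ _ (Num.sqrt (s * lnp) *
   (`|X| * ((Kdim + 1) * Num.sqrt s * norm2 v)))).
  rewrite ler_wpM2l//; apply: le_trans (predictor_le_norm2 v i) _.
  by rewrite ler_wpM2l// ler_wpM2r// norm2_ge0.
rewrite sqrtrM// [leLHS](_ : _ = (Kdim + 1) *
   (`|X| * s * Num.sqrt lnp) * norm2 v); last first.
  by rewrite -[s in RHS]sqr_sqrtr//; ring.
apply: (@le_trans _ _ ((Kdim + 1) *
   (sparsity_const * phi * Num.sqrt n%:R) * norm2 v)).
  by rewrite ler_wpM2r ?norm2_ge0// ler_wpM2l// ltW.
rewrite [leLHS](_ : _ = (12 * C * direction_const)^-1 *
  (Num.sqrt n%:R * phi * norm2 v)); last first.
  by rewrite /sparsity_const; field; rewrite !gt_eqF.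
rewrite ler_wpM2l ?norm2_le_form// invr_ge0 !mulr_ge0// ltW//.
Qed.

End submodel.

(** A coordinate vector is sparse, and its quotient is the weighted mean square of
    one column. *)
Lemma phi2_tilde_le : phi <= Ccol * sigma.
Proof.
have p0 : (0 < p)%N by apply: leq_trans p6.
pose j := Ordinal p0; pose t : 'cV[R]_p := delta_mx j 0.
have nt : norm2 t = 1.
  rewrite /norm2 (bigD1 j)//= big1 => [|l lj]; first by rewrite mxE !eqxx expr1n addr0 sqrtr1.
  by rewrite mxE (negbTE lj) expr0n.
have st : #|supp t|%:R <= (Kdim + 1) * s.
  apply: (@le_trans _ _ 1); last first.
    by rewrite -[leLHS]mulr1 ler_pM// lerDr ltW// (lt_trans ltr01).
  rewrite lern1 -(cards1 j); apply/subset_leq_card/fintype.subsetP => l.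
  by rewrite !inE mxE eqxx andbT; case: (l == j); rewrite ?eqxx.
have := @phi2_le R n p X (fun i => V (eta i)) (fun i => V0 _) _ n0 t phi0 st.
rewrite nt expr1n mulr1 => H.
have {}H : n%:R * phi ^+ 2 <= sigma2_max b M * (Ccol ^+ 2 * n%:R).
  apply: le_trans H _; apply: le_trans (sum_weight_column j).
  by apply: ler_sum => i _; rewrite /t -colE [col _ _ _ _]mxE.
have {}H : phi ^+ 2 <= (Ccol * sigma) ^+ 2.
  rewrite exprMn (sqr_sqrtr sigma2_max_ge0) -(ler_pM2l nR).
  by rewrite [leRHS](_ : _ = sigma2_max b M * (Ccol ^+ 2 * n%:R)) ?H//; ring.
have ? : 0 <= Ccol * sigma by rewrite mulr_ge0.
by rewrite -(@ler_pXn2r _ 2)// nnegrE ltW.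
Qed.

Lemma nu_ge : 1 + sigma2_max b M <= nu b M.
Proof.
have l2 : 0 < ln 2 :> R by apply: ln_gt0; rewrite ltr1n.
have l21 : ln 2 <= 1 :> R.
  by have := @le_ln1Dx R 1; rewrite -[1 + 1]/(2 : R); apply; rewrite (lt_trans (ltrN10 _) ltr01).
apply: (@le_trans _ _ (1 * (1 + sigma2_max b M / ln 2))).
  rewrite mul1r lerD2l -[leLHS]mulr1 ler_wpM2l ?sigma2_max_ge0//.
  by rewrite invf_ge1.
rewrite ler_wpM2r//.
  by rewrite addr_ge0// divr_ge0 ?sigma2_max_ge0// ltW.
by rewrite lerDl divr_ge0// mulr_ge0 ?expR_ge0// ltW.
Qed.

(** [C Ccol^2] is the variance factor of the Chernoff bound, and 3 leaves
    [2 p / p^3] after the union over coordinates and signs. *)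
Definition score_const : R := C * Ccol ^+ 2 + 3.

Let pE : p%:R = expR lnp :> R.
Proof. by rewrite lnK// posrE; apply: lt_le_trans pR. Qed.

Let pinvE : p%:R^-1 = expR (- lnp) :> R. Proof. by rewrite expRN -pE. Qed.
Let pXE N : (p ^ N)%:R = expR (N%:R * lnp) :> R.
Proof. by rewrite natrX expRM_natl -pE. Qed.

Let responses := model_response model.
Let independent : mutually_independent (resp M). Proof. by case: model. Qed.

Lemma score_event : with_prob_ge P (1 - p%:R^-1)
  [set w | forall j, `|\sum_i X i j * eps i w| <=
     score_const * nu b M * Num.sqrt (n%:R * lnp)].
Proof.
set L := score_const * _ * _; set t := Num.sqrt (lnp / n%:R).
have t0 : 0 < t by rewrite sqrtr_gt0 divr_gt0.
have nu0 : 0 <= nu b M.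
  by apply: le_trans nu_ge; rewrite addr_ge0// sigma2_max_ge0.
have sc0 : 0 <= score_const.
  by rewrite addr_ge0// mulr_ge0 ?sqr_ge0// ltW.
have L0 : 0 <= L by apply: mulr_ge0 => //; exact: mulr_ge0.
have column j : C * (\sum_i V (eta i) * X i j ^+ 2) <=
    C * (sigma2_max b M * (Ccol ^+ 2 * n%:R)).
  by rewrite ler_wpM2l ?sum_weight_column// ltW.
have := noise_coordinates family C1 devC independent responses t0 design_small L0 column.
apply: with_prob_ge_sub => //; rewrite lerD2l lerN2.
have tt : t ^+ 2 * n%:R = lnp by rewrite sqr_sqrtr ?divfK ?gt_eqF// ltW// divr_gt0.
have tL : t * L = score_const * nu b M * lnp.
  rewrite /L mulrCA; congr (_ * _).
  rewrite /t -sqrtrM ?ltW ?divr_gt0// (_ : lnp / n%:R * (n%:R * lnp) = lnp ^+ 2); last first.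
    by field; rewrite gt_eqF.
  by rewrite sqrtr_sqr gtr0_norm.
have expo : t ^+ 2 * (C * (sigma2_max b M * (Ccol ^+ 2 * n%:R))) - t * L <= - (3 * lnp).
  rewrite tL (_ : t ^+ 2 * _ = C * Ccol ^+ 2 * sigma2_max b M * (t ^+ 2 * n%:R)); last by ring.
  rewrite tt -mulrBl -[leRHS]mulNr ler_wpM2r ?(ltW lnp0)//.
  rewrite lerBlDr addrC -lerBlDr opprK.
  apply: (@le_trans _ _ (score_const * (1 + sigma2_max b M))); last first.
    by rewrite ler_wpM2l// nu_ge.
  rewrite -subr_ge0 (_ : _ - _ = C * Ccol ^+ 2 + 3 * sigma2_max b M); last first.
    by rewrite /score_const; ring.
  by rewrite addr_ge0// mulr_ge0 ?sqr_ge0 ?sigma2_max_ge0// ltW.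
apply: (@le_trans _ _ ((2 * p)%:R * expR (- (3 * lnp)))).
  by rewrite ler_wpM2l// ler_expR.
have -> : expR (- (3 * lnp)) = p%:R^-1 ^+ 3.
  by rewrite pinvE -expRM_natl mulrN.
have p0 : 0 < p%:R :> R by apply: lt_le_trans pR.
rewrite natrM (_ : _ * _ = 2 / p%:R * p%:R^-1); last by field; rewrite gt_eqF.
rewrite ler_piMl ?invr_ge0 ?(ltW p0)// ler_pdivrMr// mul1r.
by apply: le_trans pR; rewrite ler_nat.
Qed.

Lemma direction_event : with_prob_ge P (1 - p%:R^-1)
  [set w | forall S : {set 'I_p}, (S0 M \subset S) && (#|S|%:R <= (Kdim + 1) * s) ->
     forall v : 'cV[R]_#|S|, \sum_i eps i w * (cols X S *m v) i 0 <=
       2 * direction_const * Num.sqrt (s * lnp) *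
       Num.sqrt (fisher_form b (cols X S) (true_restriction S) v)].
Proof.
set T := Num.sqrt (s * lnp).
have T0 : 0 < T by rewrite sqrtr_gt0 mulr_gt0// (lt_le_trans ltr01).
have TT : T ^+ 2 = s * lnp by rewrite sqr_sqrtr// mulr_ge0// ltW.
pose Q (S : {set 'I_p}) := (S0 M \subset S) && (#|S|%:R <= (Kdim + 1) * s).
pose N := Num.truncn ((Kdim + 1) * s).
have Ks0 : 0 <= (Kdim + 1) * s by rewrite mulr_ge0// ltW.
have N_le : N%:R <= (Kdim + 1) * s by case/andP: (truncn_itv Ks0).
have Q0 (S : {set 'I_p}) : Q S -> (0 < #|S|)%N.
  by case/andP => /subset_leq_card /(leq_trans s0_gt0).
have cardQ : (#|Q| <= p ^ N)%N.
  have := @card_small_sets 'I_p N; rewrite card_ord; apply: leq_trans.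
  apply/subset_leq_card/fintype.subsetP => S QS.
  rewrite inE -card_gt0 (Q0 S QS)/=; case/andP: QS => _ SK.
  have /andP[_] := truncn_itv Ks0; rewrite -/N => /(le_lt_trans SK).
  by rewrite ltr_nat ltnS.
pose r := expR (2 * ((Kdim + 1) * s) * lnp + (C - direction_const) * T ^+ 2).
have r0 : 0 <= r := expR_ge0 _.
apply: with_prob_ge_sub (@with_prob_ge_all _ _ _ P _ Q r _
   (fun S w => forall v : 'cV[R]_#|S|, \sum_i eps i w * (cols X S *m v) i 0 <=
       2 * direction_const * T *
       Num.sqrt (fisher_form b (cols X S) (true_restriction S) v)) r0 cardQ _) => //.
  rewrite lerD2l lerN2 pXE pinvE -expRD ler_expR TT.
  have H1 : N%:R * lnp <= (Kdim + 1) * s * lnp by rewrite ler_wpM2r// ltW.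
  have H2 : lnp <= s * lnp by rewrite ler_peMl// ltW.
  rewrite -subr_ge0 (_ : _ - _ = ((Kdim + 1) * s * lnp - N%:R * lnp) +
    (s * lnp - lnp)); last by rewrite /direction_const; ring.
  by rewrite addr_ge0 ?subr_ge0.
move=> S QS; have /andP[S0S Ssmall] := QS.
have qE (v : 'cV[R]_#|S|) : fisher_form b (cols X S) (true_restriction S) v =
    \sum_i V (eta i) * (cols X S *m v) i 0 ^+ 2.
  by rewrite /fisher_form mul_true_restriction.
have K12 : (12 * C * direction_const)^-1 <= 2^-1.
  rewrite lef_pV2 ?posrE ?mulr_gt0//.
  have ct1 : 1 <= direction_const.
    by rewrite /direction_const lerDr addr_ge0 ?mulr_ge0// ltW.
  apply: (@le_trans _ _ (12 * 1)); first by rewrite mulr1 ler_nat.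
  by rewrite -mulrA ler_pM2l// -[1]mulr1 ler_pM.
have Sp : (#|S| <= p)%N by rewrite -[p in leqRHS]card_ord max_card.
have := @noise_directions _ _ _ _ _ family _ C1 devC _ _ P _ _ _ independent responses
  _ (cols X S) T direction_const T0 (Q0 S QS).
move=> /(_ _ _)/with_prob_ge_sub; apply.
- rewrite lerD2l lerN2 /r expRD ler_wpM2r ?expR_ge0//.
  apply: (@le_trans _ _ ((p ^ (2 * #|S|))%:R)).
    rewrite ler_nat expnM leq_exp2r ?Q0// -mulnn.
    apply: (@leq_trans (6 * p)); last by rewrite leq_mul2r p6 orbT.
    rewrite mulnS mulnA -[(6 * p)%N]/((2 + 2 * 2) * p)%N mulnDl leq_add ?leq_mul2l ?Sp//.
    by rewrite leq_pmulr// (leq_trans _ p6).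
  rewrite pXE ler_expR ler_wpM2r ?(ltW lnp0)// natrM ler_wpM2l//.
- by move=> w H v; rewrite qE; exact: H.
- by move=> v v0; rewrite -qE; exact: submodel_form_gt0.
- move=> v i; rewrite -qE; apply: le_trans (predictor_le_form S0S Ssmall v i) _.
  by rewrite ler_wpM2r.
Qed.

Definition bound_const : R :=
  score_const + sparsity_const * Ccol * 2 * remainder_const C *
    (6 * C * direction_const) ^+ 2.

Lemma S_fp_sub S : S \in S_fp b M Kdim Ktheta ->
  (S0 M \subset S) && (#|S|%:R <= (Kdim + 1) * s).
Proof.
case/imsetP => S'; rewrite inE => /andP[+ _] ->; rewrite inE => /andP[S'K _].
rewrite finset.subsetUr/= mulrDl mul1r; apply: le_trans (lerD S'K (lexx _)).
by rewrite -natrD ler_nat cardsU leq_subr.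
Qed.

(** The factor [2 + sigma] of the remainder meets a factor [sigma] coming from
    [sparsity] and [phi2_tilde_le], and [sigma (2 + sigma) <= 2 nu]. *)
Lemma remainder_term_le : `|X| * (remainder_const C * (2 + sigma) *
    (3 * C * (2 * direction_const * Num.sqrt (s * lnp))) ^+ 2) <=
  (bound_const - score_const) * nu b M * Num.sqrt (n%:R * lnp).
Proof.
have K0 := remainder_const_ge0 (ltW C0).
have sig0 : 0 <= sigma := sqrtr_ge0 _.
have lnp' : 0 <= lnp := ltW lnp0.
have sc0 : 0 <= sparsity_const by rewrite invr_ge0 !mulr_ge0// ltW.
set rl := Num.sqrt lnp; set Q := Num.sqrt (n%:R * lnp).
have QE : Q = Num.sqrt n%:R * rl by rewrite /Q sqrtrM.
have E : (3 * C * (2 * direction_const * Num.sqrt (s * lnp))) ^+ 2 =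
    (6 * C * direction_const) ^+ 2 * (s * (rl * rl)).
  rewrite (_ : 3 * C * _ = (6 * C * direction_const) * Num.sqrt (s * lnp)); last by ring.
  rewrite exprMn (sqr_sqrtr (mulr_ge0 _ lnp'))//.
  by rewrite -expr2 (sqr_sqrtr lnp').
rewrite E [leLHS](_ : _ = remainder_const C * (6 * C * direction_const) ^+ 2 *
  ((2 + sigma) * (`|X| * s * rl * rl))); last by ring.
have step : `|X| * s * rl * rl <= sparsity_const * (Ccol * sigma) * Q.
  rewrite QE [leRHS]mulrA ler_wpM2r ?sqrtr_ge0//; apply: le_trans sparsity _.
  by rewrite ler_wpM2r ?sqrtr_ge0// ler_wpM2l// phi2_tilde_le.
have quad : (2 + sigma) * sigma <= 2 * nu b M.
  apply: (@le_trans _ _ (2 * (1 + sigma ^+ 2))).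
    rewrite -subr_ge0 (_ : _ - _ = 1 + (1 - sigma) ^+ 2); last by ring.
    by rewrite addr_ge0 ?sqr_ge0.
  by rewrite ler_pM2l// (sqr_sqrtr sigma2_max_ge0) nu_ge.
apply: (@le_trans _ _ (remainder_const C * (6 * C * direction_const) ^+ 2 *
  ((2 + sigma) * (sparsity_const * (Ccol * sigma) * Q)))).
  rewrite ler_wpM2l//; first by rewrite mulr_ge0// sqr_ge0.
  by rewrite ler_wpM2l// addr_ge0.
rewrite [leLHS](_ : _ = remainder_const C * (6 * C * direction_const) ^+ 2 *
  (sparsity_const * Ccol) * Q * ((2 + sigma) * sigma)); last by ring.
rewrite [leRHS](_ : _ = remainder_const C * (6 * C * direction_const) ^+ 2 *
  (sparsity_const * Ccol) * Q * (2 * nu b M)); last by rewrite /bound_const; ring.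
rewrite ler_wpM2l//; apply: mulr_ge0; last exact: sqrtr_ge0.
by apply: mulr_ge0; [rewrite mulr_ge0// sqr_ge0|exact: mulr_ge0].
Qed.

Lemma mle_bound (kappa : R) :
  (forall S, S \in S_fp b M Kdim Ktheta ->
     row_sum_norm (invmx (F_star b k S)) <= kappa * n%:R^-1) ->
  with_prob_ge P (1 - 3 * p%:R^-1)
    [set w | forall S, S \in S_fp b M Kdim Ktheta ->
       is_mle b k w (mle b k S w) /\
       `|mle b k S w - theta_star b k S|
         <= bound_const * nu b M * kappa * Num.sqrt (lnp / n%:R)].
Proof.
move=> kappaP.
have pinv0 : 0 <= p%:R^-1 :> R by rewrite invr_ge0.
apply: with_prob_ge_sub (with_prob_geI score_event direction_event).
  by rewrite lerD2l lerN2; lra.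
move=> w [/= score_le direction_le] S SS.
have SQ := S_fp_sub SS; have /andP[S0S Ssmall] := SQ.
have starE : theta_star b k S = true_restriction S.
  apply: (theta_star_unique family model); first exact: mul_true_restriction.
  exact: submodel_inj.
set Z := cols X S; set t0 := true_restriction S.
have Zt0 : Z *m t0 = X *m theta0 by exact: mul_true_restriction.
pose y i := resp M i w; pose c i := k (resp M i w).
have resE i : residual b Z t0 y i = eps i w by rewrite /residual Zt0.
set tau := 2 * direction_const * Num.sqrt (s * lnp).
have tau0 : 0 < tau.
  by rewrite !mulr_gt0// sqrtr_gt0 mulr_gt0// (lt_le_trans ltr01).
have residual_le v : \sum_i residual b Z t0 y i * (Z *m v) i 0 <=
    tau * Num.sqrt (fisher_form b Z t0 v).
  under eq_bigr do rewrite resE; exact: direction_le.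
have predictor_le v i : `|(Z *m v) i 0| * (3 * C * tau) <=
    2^-1 * Num.sqrt (fisher_form b Z t0 v).
  rewrite [leLHS](_ : _ = 6 * C * direction_const *
    (Num.sqrt (s * lnp) * `|(Z *m v) i 0|)); last by rewrite /tau; ring.
  have ct : 0 <= 6 * C * direction_const by rewrite !mulr_ge0// ltW.
  apply: le_trans (ler_wpM2l ct (predictor_le_form S0S Ssmall v i)) _.
  by rewrite mulrA (_ : _ / _ = 2^-1)//; field; rewrite !gt_eqF.
have sphi0 : 0 < Num.sqrt n%:R * phi by rewrite mulr_gt0// sqrtr_gt0.
have norm_le v : `|v| <= (Num.sqrt n%:R * phi)^-1 * Num.sqrt (fisher_form b Z t0 v).
  rewrite ler_pdivlMl//; apply: le_trans (norm2_le_form S0S Ssmall v).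
  rewrite ler_pM2l//; apply: mx_norm_le_entries; first exact: norm2_ge0.
  by move=> i j; rewrite ord1; exact: entry_le_norm2.
have beta0 : 0 <= (Num.sqrt n%:R * phi)^-1 by rewrite invr_ge0 ltW.
have mleP : is_argmax (log_likelihood b Z y c) (mle b k S w).
  have ex := mle_exists family C1 devC c tau0 residual_le predictor_le beta0 norm_le.
  exact: (@xgetPex _ _ [set t | is_argmax (log_likelihood b Z y c) t]).
split; first exact: mleP.
rewrite starE -/t0.
set g := score_const * nu b M * Num.sqrt (n%:R * lnp).
have nu0 : 0 <= nu b M.
  by apply: le_trans nu_ge; rewrite addr_ge0// sigma2_max_ge0.
have g0 : 0 <= g.
  rewrite /g; apply: mulr_ge0; last exact: sqrtr_ge0.
  by apply: mulr_ge0 => //; rewrite addr_ge0// mulr_ge0 ?sqr_ge0// ltW.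
have Zle i j : `|Z i j| <= `|X| by rewrite mxE; exact: mx_entry_le_norm.
have sigma_le i : Num.sqrt (V ((Z *m t0) i 0)) <= sigma.
  by rewrite Zt0 ler_wsqrtr// sigma2_max_ge.
have gle j : `|\sum_i Z i j * residual b Z t0 y i| <= g.
  rewrite (eq_bigr (fun i => X i (enum_val j) * eps i w)) ?score_le// => i _.
  by rewrite resE mxE.
have Funit : fisher b Z t0 \in unitmx.
  by apply: fisher_unit => v; exact: submodel_form_gt0.
apply: le_trans (mle_error family C1 devC tau0 residual_le predictor_le mleP
   (normr_ge0 X) Zle (sqrtr_ge0 _) sigma_le g0 gle Funit) _.
have rowle : row_sum_norm (invmx (fisher b Z t0)) <= kappa * n%:R^-1.
  by have := kappaP S SS; rewrite /F_star /F_ starE.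
have row0 : 0 <= row_sum_norm (invmx (fisher b Z t0)) by exact: bigmax_ge_id.
set B := (g + _).
have B_le : B <= bound_const * nu b M * Num.sqrt (n%:R * lnp).
  apply: le_trans (lerD (lexx g) remainder_term_le) _.
  by rewrite /g -!mulrDl addrC subrK.
apply: (@le_trans _ _ (kappa * n%:R^-1 *
    (bound_const * nu b M * Num.sqrt (n%:R * lnp)))).
  apply: le_trans (ler_wpM2l row0 B_le) _; apply: ler_wpM2r rowle.
  apply: le_trans B_le; apply: addr_ge0 => //; apply: mulr_ge0 => //.
  apply: mulr_ge0; last exact: sqr_ge0.
  by apply: mulr_ge0; [exact: remainder_const_ge0 (ltW C0)|exact: addr_ge0].
have -> : Num.sqrt (n%:R * lnp) = n%:R * Num.sqrt (lnp / n%:R).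
  rewrite (_ : n%:R * lnp = n%:R ^+ 2 * (lnp / n%:R)); last by field; rewrite gt_eqF.
  by rewrite sqrtrM ?sqr_ge0// sqrtr_sqr gtr0_norm.
rewrite [leLHS](_ : _ = bound_const * nu b M * kappa * Num.sqrt (lnp / n%:R))//.
by field; rewrite gt_eqF.
Qed.

End one_sample.

(** * The asymptotic statement *)

Lemma nbhs_pow_ge (R : realType) (c a : R) : 0 < c -> 0 <= a ->
  \forall n \near \oo, a <= n%:R `^ c.
Proof.
move=> c0 a0; near=> n.
have an : a `^ c^-1 <= n%:R by near: n; exact: nbhs_infty_ger.
have -> : a = (a `^ c^-1) `^ c by rewrite -powRrM mulVf ?gt_eqF// powRr1.
by apply: ge0_ler_powR; rewrite ?nnegrE ?powR_ge0 ?(ltW c0).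
Unshelve. all: by end_near. Qed.

Theorem theorem5p3 (R : realType)
  (b k : R -> R) (mu : {measure set (measurableTypeR R) -> \bar R}) (Dom : set R)
  (Hfamily : glm_family b k mu Dom)
  (Cdev : R) (HCdev_ge1 : 1 <= Cdev)
  (HCdev : forall x y : R, `|y| <= 2^-1 ->
     derive1n 2 b (x + y) <= Cdev * derive1n 2 b x)
  (M : forall n, glm R n)
  (Hmodel : forall n, glm_model b k (M n) mu Dom)
  (Htruth : \forall n \near \oo, truth (M n) != 0)
  (c : R) (Hc : 0 < c)
  (Hp : \forall n \near \oo, n%:R `^ c <= (ncov (M n))%:R)
  (smax : nat -> nat)
  (Hsmax : \forall n \near \oo,
     (s0 (M n) <= smax n)%N /\ (smax n <= \rank (design (M n)))%N)
  (wgt : nat -> nat -> R) (A1 A2 A3 A4 : R)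
  (HA1 : 0 < A1) (HA2 : 0 < A2) (HA3 : 0 < A3) (HA4 : 0 < A4)
  (Hwgt : \forall n \near \oo,
     prior_weights (M n) (smax n) (wgt n) A1 A2 A3 A4)
  (lambda : nat -> R) (Hlambda_gt0 : \forall n \near \oo, 0 < lambda n)
  (alpha : R)
  (Kdim Ktheta : R) (HKdim_gt1 : 1 < Kdim) (HKtheta_gt0 : 0 < Ktheta)
  (HKdim : \forall n \near \oo,
     ('E_(prob (M n))[frac_posterior b k (smax n) (wgt n) (lambda n) alpha
         [set theta | (Kdim * (s0 (M n))%:R < #|supp theta|%:R)%R]]
      <= (((s0 (M n))%:R * ln (ncov (M n))%:R)^-1 + 2 * (ncov (M n))%:R^-1
          + (ncov (M n))%:R ^- s0 (M n))%:E)%E)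
  (HKtheta : \forall n \near \oo,
     ('E_(prob (M n))[frac_posterior b k (smax n) (wgt n) (lambda n) alpha
         [set theta | (Ktheta * (s0 (M n))%:R * ln (ncov (M n))%:R
                       < dist0 b theta)%R]]
      <= (2 * ((s0 (M n))%:R * ln (ncov (M n))%:R)^-1 + 4 * (ncov (M n))%:R^-1
          + 2 * (ncov (M n))%:R ^- s0 (M n))%:E)%E)
  (D : nat -> R) (HD : \forall n \near \oo, Num.sqrt 2 < D n)
  (theta_bar : forall n (S : {set 'I_(ncov (M n))}), 'cV[R]_#|S|)
  (Htheta_bar : \forall n \near \oo, forall S : {set 'I_(ncov (M n))},
     (#|S| <= smax n)%N -> F_ b (theta_bar n S) \in unitmx)
  (H1_event : \forall n \near \oo,
     with_prob_ge (prob (M n)) (1 - (ncov (M n))%:R^-1)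
       [set w | forall S : {set 'I_(ncov (M n))}, (#|S| <= smax n)%N ->
          let Fbar := F_ b (theta_bar n S) in
          let Fhat := F_ b (mle b k S w) in
          [/\ is_mle b k w (mle b k S w),
              loewner_le ((D n)^-1 *: Fbar) Fhat,
              loewner_le Fhat (D n *: Fbar) &
              norm2 (sqrtmx Fbar *m (mle b k S w - theta_bar n S)) ^+ 2
                <= D n * #|S|%:R * ln (ncov (M n))%:R]])
  (H1_unit : \forall n \near \oo, F_star b k (S0 (M n)) \in unitmx)
  (H1_zeta : (fun n => zeta b k (S0 (M n)) ^+ 2 * (s0 (M n))%:R
                       * ln (ncov (M n))%:R) @ \oo --> 0)
  (H2_log :
     (fun n => ln (Num.max (Num.max (Num.max
                  (sigma2_max b (M n))
                  (row_sum_norm (cols (design (M n)) (S0 (M n)))))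
                  (rho_min b k (S0 (M n)))^-1%R)
                  (rho_max b k (S0 (M n)))))
     =O_\oo (fun n => ln (ncov (M n))%:R))
  (H2_s0 : (fun n => (s0 (M n))%:R * ln (ncov (M n))%:R) =o_\oo
           (fun n => n%:R : R))
  (A5 A6 A7 : R) (HA5 : 0 < A5) (HA6 : 0 < A6) (HA7 : 0 <= A7)
  (H2_lambda : \forall n \near \oo,
     (ncov (M n))%:R `^ (- A5) <= lambda n <= A6 * (ncov (M n))%:R `^ (- A7))
  (H2_alpha : 0 < alpha < 1)
  (H2_A4 : \forall n \near \oo, A6 * (ncov (M n))%:R `^ (- A7) < A4)
  (H2_D : (fun n => logp (M n) (D n)) @ \oo --> 0)
  (* phi_2 > 0 is implicit in the quotients by phi_2 below: x / 0 = 0 here *)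
  (H3_phi2_gt0 : \forall n \near \oo, 0 < phi2_tilde b (M n) Kdim)
  (H3 : (fun n => `|design (M n)| ^+ 2 * (s0 (M n))%:R ^+ 2
                  * ln (ncov (M n))%:R / phi2_tilde b (M n) Kdim ^+ 2)
        =o_\oo (fun n => n%:R : R))
  (A8 Kcubic : R) (HA8 : 0 < A8) (HKcubic : 0 < Kcubic)
  (H4_rho : \forall n \near \oo, forall S, S \in S_Theta b (M n) Kdim Ktheta ->
     rho_max b k S <= (ncov (M n))%:R `^ A8)
  (H4_cubic : \forall n \near \oo,
     forall S, S \in S_Theta_bar b (M n) Kdim Ktheta ->
     forall u : 'cV[R]_#|S|, norm2 u = 1 ->
       n%:R^-1 * (\sum_(i < n) `|(cols (design (M n)) S *m u) i 0| ^+ 3)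
         <= Kcubic)
  (H4_small :
     (fun n => Num.min
        (Num.sqrt ((s0 (M n))%:R ^+ 3 * ln (ncov (M n))%:R)
         * max_zeta b k (S_Theta b (M n) Kdim Ktheta))
        (sigma2_max b (M n) / phi2_tilde b (M n) Kdim ^+ 3
         * Num.sqrt ((s0 (M n))%:R ^+ 3 * ln (ncov (M n))%:R / n%:R)))
     @ \oo --> 0)
  (delta1 : R) (Hdelta1 : 0 < delta1)
  (H5_A4 : \forall n \near \oo,
     16 * alpha * Cdev + logp (M n) (s0 (M n))%:R + delta1 < A4 + A7 / 2)
  (H5_small :
     (fun n => Num.min
        (Num.sqrt ((s0 (M n))%:R ^+ 3 * ln (ncov (M n))%:R)
         * max_zeta b k (S_Theta_tilde b (M n) Kdim Ktheta))
        (sigma2_max b (M n) / phi2_tilde b (M n) Kdim ^+ 3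
         * Num.sqrt ((s0 (M n))%:R ^+ 3 * ln (ncov (M n))%:R / n%:R)))
     @ \oo --> 0)
  (H6_X : (fun n => `|design (M n)| ^+ 2 * ln (ncov (M n))%:R) =o_\oo
          (fun n => n%:R : R))
  (H6_col : (fun n => \big[Num.max/0]_(j < ncov (M n)) norm2 (col j (design (M n))))
            =O_\oo (fun n => Num.sqrt n%:R : R))
  (kappa : nat -> R) (Hkappa_gt1 : \forall n \near \oo, 1 < kappa n)
  (H6_kappa : \forall n \near \oo, forall S, S \in S_fp b (M n) Kdim Ktheta ->
     row_sum_norm (invmx (F_star b k S)) <= kappa n * n%:R^-1)
  (H6_small :
     (fun n => Num.min
        (Num.sqrt ((s0 (M n))%:R ^+ 2 * ln (ncov (M n))%:R)
         * max_zeta b k (S_fp b (M n) Kdim Ktheta)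
         / (phi2_tilde b (M n) Kdim * nu b (M n) * kappa n))
        (sigma2_max b (M n)
         / (phi2_tilde b (M n) Kdim ^+ 4 * nu b (M n) * kappa n)
         * Num.sqrt ((s0 (M n))%:R ^+ 2 * ln (ncov (M n))%:R / n%:R)))
     @ \oo --> 0) :
  exists K : R, 0 < K /\
    \forall n \near \oo,
      with_prob_ge (prob (M n)) (1 - 3 * (ncov (M n))%:R^-1)
        [set w | forall S, S \in S_fp b (M n) Kdim Ktheta ->
           is_mle b k w (mle b k S w) /\
           `|mle b k S w - theta_star b k S|
             <= K * nu b (M n) * kappa n * Num.sqrt (ln (ncov (M n))%:R / n%:R)].
Proof.
have [Ccol Ccol0 col_le] := (eqO_exP _ _ _).1 H6_col.
have sc0 : 0 < sparsity_const Cdev Kdim.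
  have C0 : 0 < Cdev := lt_le_trans ltr01 HCdev_ge1.
  rewrite invr_gt0 /direction_const !mulr_gt0// ?addr_gt0 ?mulr_gt0 ?addr_gt0 ?(lt_trans ltr01 HKdim_gt1)//.
have sparse := (eqoP _ _ _).1 H3 _ (exprn_gt0 2 sc0).
have q0 : 0 < 4^-1 :> R by rewrite invr_gt0.
have small := (eqoP _ _ _).1 H6_X _ q0.
have p_large := nbhs_pow_ge Hc (ler0n R 6).
exists (bound_const Cdev Kdim Ccol); split.
  have C0 : 0 <= Cdev := le_trans ler01 HCdev_ge1.
  rewrite ltr_wpDr//.
    rewrite mulr_ge0 ?sqr_ge0// mulr_ge0 ?remainder_const_ge0//.
    by rewrite !mulr_ge0// ltW.
  by rewrite /score_const ltr_wpDl// mulr_ge0// sqr_ge0.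
near=> n.
have n0 : (0 < n)%N by near: n; exact: nbhs_infty_gt.
have nR : 0 < n%:R :> R by rewrite ltr0n.
have p6 : (6 <= ncov (M n))%N.
  rewrite -(ler_nat R); apply: (@le_trans _ _ (n%:R `^ c)); near: n; [exact: p_large|exact: Hp].
have lnp0 : 0 <= ln (ncov (M n))%:R :> R.
  by rewrite ln_ge0// ler1n (leq_trans _ p6).
have phi0 : 0 < phi2_tilde b (M n) Kdim by near: n; exact: H3_phi2_gt0.
have phi0' := ltW phi0.
have rows S : S \in S_fp b (M n) Kdim Ktheta ->
    row_sum_norm (invmx (F_star b k S)) <= kappa n * n%:R^-1.
  by move: S; near: n; exact: H6_kappa.
apply: (mle_bound Hfamily HCdev_ge1 HCdev (Hmodel n) HKdim_gt1 (ltW Ccol0)) => //.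
- by near: n; exact: Htruth.
- have : `| `|design (M n)| ^+ 2 * ln (ncov (M n))%:R| <= 4^-1 * `|n%:R : R|.
    by near: n; exact: small.
  rewrite !ger0_norm ?mulr_ge0 ?sqr_ge0// => H.
  rewrite -(@ler_pXn2r _ 2) ?nnegrE ?mulr_ge0 ?sqrtr_ge0 ?invr_ge0//.
  rewrite exprMn sqr_sqrtr ?divr_ge0// mulrC mulrA ler_pdivrMr//.
  by apply: le_trans H _; rewrite exprVn -natrX.
- move=> j.
  have : `|\big[Num.max/0]_(j < ncov (M n)) norm2 (col j (design (M n)))| <=
      Ccol * `|Num.sqrt n%:R : R|.
    by near: n; exact: col_le.
  rewrite (ger0_norm (sqrtr_ge0 _)) => H; apply: le_trans H.
  apply: le_trans (ler_norm _).
  exact: (@le_bigmax _ _ _ 0 (fun j => norm2 (col j (design (M n))))).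
- have : `| `|design (M n)| ^+ 2 * (s0 (M n))%:R ^+ 2
      * ln (ncov (M n))%:R / phi2_tilde b (M n) Kdim ^+ 2| <=
      sparsity_const Cdev Kdim ^+ 2 * `|n%:R : R|.
    by near: n; exact: sparse.
  rewrite !ger0_norm ?divr_ge0 ?mulr_ge0 ?sqr_ge0//.
  rewrite ler_pdivrMr ?exprn_gt0// => H.
  rewrite -(@ler_pXn2r _ 2)// ?nnegrE; last 2 first.
  - by apply: mulr_ge0; [exact: mulr_ge0|exact: sqrtr_ge0].
  - by apply: mulr_ge0; [apply: mulr_ge0; exact: ltW|exact: sqrtr_ge0].
  rewrite !exprMn (sqr_sqrtr lnp0) (sqr_sqrtr (ltW nR)); apply: le_trans H _.
  by rewrite mulrAC.
Unshelve. all: by end_near. Qed.
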